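(* Let $W\in(0,\frac12)$, let $N\ge1$ be an integer, and put $c=\pi N W$. With the convention $\widetilde\lambda_{k,N}(W)=0$ for $k\ge N$, $$\left(\sum_{k=0}^{\infty}\big|\widetilde\lambda_{k,N}(W)-\lambda_k(c)\big|^2\right)^{1/2}\le W^3\left(\frac{4\pi^2}{3\sin(2\pi W)}\right).$$
   Context: For $W\in(0,1/2)$ and an integer $N\ge1$, let $\widetilde Q_{W,N}$ be the positive, self-adjoint integral operator of rank $N$ on $L^2(-W,W)$ given by $$\widetilde Q_{W,N}f(x)=\int_{-W}^{W}\frac{\sin(N\pi(x-y))}{\sin(\pi(x-y))}f(y)\,dy.$$ Its $N$ nonzero eigenvalues, in decreasing order, are denoted $1>\widetilde\lambda_{0,N}(W)>\widetilde\lambda_{1,N}(W)>\cdots>\widetilde\lambda_{N-1,N}(W)>0$. For $c>0$, let $\mathcal Q_c$ be the Sinc-kernel operator on $L^2(-1,1)$, $$\mathcal Q_cf(x)=\int_{-1}^{1}\frac{\sin(c(x-y))}{\pi(x-y)}f(y)\,dy,$$ a positive compact self-adjoint operator whose eigenvalues in decreasing order are denoted $\lambda_0(c)>\lambda_1(c)>\cdots>0$. *)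

(* Defs.v *)
From HB Require Import structures.
From mathcomp Require Import all_boot all_order all_algebra.
From mathcomp Require Import all_classical all_reals all_analysis.

Set Implicit Arguments.
Unset Strict Implicit.
Unset Printing Implicit Defensive.

Import Order.TTheory GRing.Theory Num.Theory.
Import numFieldNormedType.Exports.

Local Open Scope classical_set_scope.
Local Open Scope ring_scope.

(* Lebesgue measure carried by the interval (-a, a).  An element of
   L^2(-a, a) is represented by a measurable function on the whole line whose
   values outside (-a, a) are irrelevant: all equalities below are almost
   everywhere for this measure. *)
Definition leb (R : realType) (a : R) : {measure set (measurableTypeR R) -> \bar R} :=
  mrestr (@lebesgue_measure R) (measurable_itv `]- a, a[).

Definition L2 (R : realType) (a : R) : set (measurableTypeR R -> R) :=
  [set f | f \in Lfun (leb a) 2%:E].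

Definition intop (R : realType) (a : R) (K : R -> R -> R)
    (f : measurableTypeR R -> R) : measurableTypeR R -> R :=
  fun x => (\int[@lebesgue_measure R]_(y in `]- a, a[) (K x y * f y))%R.

(* On the diagonal both kernels below take the value 0 (since x / 0 = 0)
   rather than their continuous extension; for each x this concerns the single
   point y = x and does not affect the integral.  For x, y in (-W, W) with
   W < 1/2 the denominator sin (pi (x - y)) vanishes only when x = y. *)
Definition Qtilde (R : realType) (W : R) (N : nat) :
    (measurableTypeR R -> R) -> (measurableTypeR R -> R) :=
  intop W (fun x y => sin (N%:R * pi * (x - y)) / sin (pi * (x - y))).

Definition Qsinc (R : realType) (c : R) :
    (measurableTypeR R -> R) -> (measurableTypeR R -> R) :=
  intop 1 (fun x y => sin (c * (x - y)) / (pi * (x - y))).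

Definition eigenspace (R : realType) (a : R)
    (T : (measurableTypeR R -> R) -> (measurableTypeR R -> R)) (mu : R) :
    set (measurableTypeR R -> R) :=
  [set f | L2 a f /\ ae_eq (leb a) setT (T f) (fun x => mu * f x)].

(* [V], a linear subspace of L^2(-a, a), has dimension [n]: it has a basis of
   [n] vectors modulo almost-everywhere equality. *)
Definition has_dim (R : realType) (a : R)
    (V : set (measurableTypeR R -> R)) (n : nat) : Prop :=
  exists e : 'I_n -> measurableTypeR R -> R,
    (forall i, V (e i)) /\
    (forall f, V f -> exists! u : 'rV[R]_n,
       ae_eq (leb a) setT f (fun x => \sum_(i < n) u 0%R i * e i x)).

(* [lam] lists the nonzero eigenvalues of the (positive, compact) operator [T]
   on L^2(-a, a) in decreasing order, each repeated according to its
   multiplicity; if there are only finitely many of them, the list is continued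
   by 0.  As every nonzero value occurs finitely often, infinitely many nonzero
   eigenvalues leave no room for a 0. *)
Definition decreasing_eigenvalues (R : realType) (a : R)
    (T : (measurableTypeR R -> R) -> (measurableTypeR R -> R))
    (lam : nat -> R) : Prop :=
  [/\ (forall j k : nat, (j <= k)%N -> lam k <= lam j),
      (forall k : nat, 0 <= lam k)
    & forall mu : R, mu != 0 ->
        exists n : nat, ([set k | lam k = mu] #= `I_n)%card /\
                        has_dim a (eigenspace a T mu) n].

(* Main.v *)
Require Import Defs.
From HB Require Import structures.
From mathcomp Require Import all_boot all_order all_algebra.
From mathcomp Require Import all_classical all_reals all_analysis.
From mathcomp Require Import measurable_realfun zify ring lra.

(* The estimate is a Hoffman-Wielandt inequality: for two symmetric kernels on
   the same finite measure space, with nonnegative eigenvalues listed in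
   decreasing order, the l^2 distance of the two lists is at most the
   Hilbert-Schmidt norm of the difference of the kernels.  Expanding both
   kernels along orthonormal eigenvectors e_i, f_j, the cross term is the sum of
   a_i b_j <e_i, f_j>^2; the weights are substochastic by Bessel's inequality,
   so summation by parts bounds it by the sum of a_i b_i.  The expansions
   converge because the residual after removing m eigenvectors has only
   eigenvalues at most the m-th one, and because both kernels are limits of
   kernels of finite rank.  Existence of an eigenvector for a nonzero residual
   comes from Schwarz's constants (see [top_kernel]).
   After the dilation x = W t the two kernels live on (-1, 1) and differ, with
   v = pi W (s - t), by W sin(N v) (1/sin v - 1/v), which is bounded uniformly.
   All functions are bounded and measurable, so that no completed L^2 space is
   needed: an L^2 eigenvector for a nonzero eigenvalue is almost everywhere
   equal to a multiple of its image under the kernel, which is bounded. *)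

Set Implicit Arguments.
Unset Strict Implicit.
Unset Printing Implicit Defensive.

Import Order.TTheory GRing.Theory Num.Theory.
Import numFieldNormedType.Exports.

Local Open Scope classical_set_scope.
Local Open Scope ring_scope.

(** * Bounded measurable functions as a real vector space *)

Section BoundedMeasurable.
Context d (T : measurableType d) (R : realType).
Implicit Types f g : T -> R.

Definition bmeas f :=
  measurable_fun setT f /\ exists M : R, forall x, `|f x| <= M.

Lemma bmeas_bound f : bmeas f -> exists2 M : R, 0 <= M & forall x, `|f x| <= M.
Proof.
move=> [_ [M fM]]; exists (Num.max M 0); first by rewrite le_max lexx orbT.
by move=> x; rewrite le_max fM.
Qed.

Lemma bmeas_cst (r : R) : bmeas (fun=> r).
Proof. by split; [exact: measurable_cst|exists `|r|]. Qed.

Lemma bmeasD f g : bmeas f -> bmeas g -> bmeas (fun x => f x + g x).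
Proof.
move=> [mf [M fM]] [mg [N gN]]; split; first exact: measurable_funD.
by exists (M + N) => x; rewrite (le_trans (ler_normD _ _))// lerD.
Qed.

Lemma bmeasM f g : bmeas f -> bmeas g -> bmeas (fun x => f x * g x).
Proof.
move=> [mf [M fM]] [mg [N gN]]; split; first exact: measurable_funM.
by exists (M * N) => x; rewrite normrM ler_pM.
Qed.

(** The boolean form lets [bfun] inherit a module structure as a subtype, so that finite linear
    combinations are available for functions and kernels alike. *)
Definition bmeas_pred : {pred T -> R} := fun f => `[<bmeas f>].

Lemma bmeas_predP f : reflect (bmeas f) (f \in bmeas_pred).
Proof. exact: asboolP. Qed.

Lemma bmeas_submod_closed : submod_closed bmeas_pred.
Proof.
split; first by apply/bmeas_predP; exact: bmeas_cst.
move=> a f g /bmeas_predP mf /bmeas_predP mg; apply/bmeas_predP.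
exact: bmeasD (bmeasM (bmeas_cst a) mf) mg.
Qed.

HB.instance Definition _ :=
  GRing.isSubmodClosed.Build R (T -> R) bmeas_pred bmeas_submod_closed.

Record bfun := BFun { bval :> T -> R; bfun_subproof : bval \in bmeas_pred }.

HB.instance Definition _ := [isSub for bval].
HB.instance Definition _ := [Choice of bfun by <:].
HB.instance Definition _ := [SubChoice_isSubLmodule of bfun by <:].

Lemma bfunP (f : bfun) : bmeas f.
Proof. by case: f => f /= /bmeas_predP. Qed.

Definition bf f (h : bmeas f) : bfun := BFun (introT (bmeas_predP f) h).

Lemma bfun_ext (f g : bfun) : f =1 g -> f = g.
Proof. by move=> fg; apply/val_inj/funext. Qed.

Lemma bfun0E x : (0 : bfun) x = 0. Proof. by []. Qed.

Lemma bfunDE (f g : bfun) x : (f + g) x = f x + g x. Proof. by []. Qed.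

Lemma bfunNE (f : bfun) x : (- f) x = - f x. Proof. by []. Qed.

Lemma bfunZE a (f : bfun) x : (a *: f) x = a * f x. Proof. by []. Qed.

Lemma bfun_sumE (I : Type) (r : seq I) (P : pred I) (F : I -> bfun) x :
  (\sum_(i <- r | P i) F i) x = \sum_(i <- r | P i) F i x.
Proof.
by elim/big_rec2: _ => // i y f _ <-.
Qed.

End BoundedMeasurable.
Arguments bfun {d} T R.

Lemma bmeas_comp d d' (T : measurableType d) (S : measurableType d')
    (R : realType) (f : T -> R) (u : S -> T) :
  measurable_fun setT u -> bmeas f -> bmeas (f \o u).
Proof.
move=> mu [mf [M fM]]; split; first exact: measurableT_comp.
by exists M => x; exact: fM.
Qed.

(** * Integrals of bounded functions against a finite measure *)

Section IntegralBounded.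
Context d (T : measurableType d) (R : realType).
Variable mu : {finite_measure set T -> \bar R}.
Implicit Types f g : T -> R.

Lemma bmeas_integrable f : bmeas f -> mu.-integrable setT (EFin \o f).
Proof.
move=> [mf [M fM]]; apply: measurable_bounded_integrable => //.
  by rewrite ltey_eq fin_num_measure.
exists M; split; first exact: num_real.
by move=> M' MM' x _; apply: le_trans (fM x) (ltW MM').
Qed.

Lemma bmeas_RintegralD f g : bmeas f -> bmeas g ->
  \int[mu]_x (f x + g x) = \int[mu]_x f x + \int[mu]_x g x.
Proof. by move=> bf bg; rewrite RintegralD//; exact: bmeas_integrable. Qed.

Lemma bmeas_RintegralZ a f : bmeas f ->
  \int[mu]_x (a * f x) = a * \int[mu]_x f x.
Proof. by move=> bf; rewrite RintegralZl//; exact: bmeas_integrable. Qed.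

Lemma bmeas_le_Rintegral f g : bmeas f -> bmeas g -> (forall x, f x <= g x) ->
  \int[mu]_x f x <= \int[mu]_x g x.
Proof.
by move=> bf bg fg; apply: le_Rintegral => //; exact: bmeas_integrable.
Qed.

Lemma bmeas_norm_Rintegral f M : bmeas f -> (forall x, `|f x| <= M) ->
  `|\int[mu]_x f x| <= M * fine (mu setT).
Proof.
move=> bf fM.
have cstE r : r * fine (mu setT) = \int[mu]_x (fun=> r) x by rewrite Rintegral_cst.
rewrite ler_norml -mulNr !cstE; apply/andP; split.
  apply: bmeas_le_Rintegral => //; first exact: bmeas_cst.
  by move=> x; have := fM x; rewrite ler_norml => /andP[].
apply: bmeas_le_Rintegral => //; first exact: bmeas_cst.
by move=> x; have := fM x; rewrite ler_norml => /andP[].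
Qed.

(* Only joint measurability is needed: the integral is by definition the
   difference of the integrals of the positive and negative parts. *)
Lemma measurable_Rintegral_param d' (S : measurableType d') (F : S * T -> R) :
  measurable_fun setT F -> measurable_fun setT (fun s => \int[mu]_x F (s, x)).
Proof.
move=> mF; rewrite /Rintegral.
apply: (@measurableT_comp _ _ _ _ _ _ fine); first exact: fine_measurable.
have [G GE mG] : exists2 G, G = EFin \o F & measurable_fun setT G.
  by exists (EFin \o F) => //; exact/measurable_EFinP.
rewrite (_ : (fun s => _) = (fun s => \int[mu]_x G^\+ (s, x) -
    \int[mu]_x G^\- (s, x))%E); last first.
  apply/funext => s; transitivity (\int[mu]_x G (s, x))%E; first by rewrite GE.
  rewrite [LHS]integralE; under eq_integral do rewrite funepos_comp/=.
  by under [X in (_ - X = _)%E]eq_integral do rewrite funeneg_comp/=.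
by apply: emeasurable_funB; apply: measurable_fun_fubini_tonelli_F => //;
  [exact: measurable_funepos|exact: measurable_funeneg].
Qed.

Lemma bmeas_section d' (S : measurableType d') (F : S * T -> R) s :
  bmeas F -> bmeas (fun x => F (s, x)).
Proof.
by move=> bF; apply: (bmeas_comp (u := fun x => (s, x)) _ bF); exact: pair1_measurable.
Qed.

Lemma bmeas_Rintegral d' (S : measurableType d') (F : S * T -> R) :
  bmeas F -> bmeas (fun s => \int[mu]_x F (s, x)).
Proof.
move=> bF; split; first exact: measurable_Rintegral_param bF.1.
have [M M0 FM] := bmeas_bound bF.
exists (M * fine (mu setT)) => s; apply: bmeas_norm_Rintegral => //.
exact: bmeas_section.
Qed.

Lemma bmeas_bounded_cvg (F : nat -> T -> R) f M : (forall n, bmeas (F n)) ->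
  bmeas f -> (forall n x, `|F n x| <= M) -> (forall x, F ^~ x @ \oo --> f x) ->
  (fun n => \int[mu]_x F n x) @ \oo --> \int[mu]_x f x.
Proof.
move=> bF bf FM Ff.
have [] := @dominated_convergence _ T R mu setT measurableT
  (fun n => EFin \o F n) (EFin \o f) (cst M%:E) _ _ _ _ _.
- by move=> n; apply/measurable_EFinP; exact: (bF n).1.
- by apply/measurable_EFinP; exact: bf.1.
- by apply/nearW => x _; apply: cvg_EFin (Ff x); exact: nearW.
- by apply: (@bmeas_integrable (cst M)); exact: bmeas_cst.
- by apply/nearW => x n _; rewrite lee_fin.
move=> _ _ h; apply: fine_cvg; rewrite fineK; first exact: h.
by apply: integrable_fin_num => //; exact: bmeas_integrable.
Qed.

End IntegralBounded.

(** * Product measure and Fubini for bounded functions *)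

Section FubiniBounded.
Context d (T : measurableType d) (R : realType).
Variable mu : {finite_measure set T -> \bar R}.

(** A separate name for the product measure, to which finiteness is attached below;
    [dot (sqmeas mu)] is then the Hilbert-Schmidt inner product of kernels. *)
Definition sqmeas : set (T * T) -> \bar R := (mu \x mu)%E.

HB.instance Definition _ := Measure.on sqmeas.

Let sqmeas_fin : fin_num_fun sqmeas.
Proof.
apply: lty_fin_num_fun => /=.
rewrite /sqmeas -setXTT product_measure1E// lte_mul_pinfty// -?ge0_fin_numE//;
  exact: fin_num_measure.
Qed.

HB.instance Definition _ := @Measure_isFinite.Build _ _ _ sqmeas sqmeas_fin.

Lemma bmeas_sqmeas (F : T * T -> R) : bmeas F ->
  \int[sqmeas]_p F p = \int[mu]_x \int[mu]_y F (x, y).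
Proof.
move=> bF; rewrite /Rintegral -integral12_prod_meas1; last first.
  exact: (bmeas_integrable sqmeas bF).
congr fine; apply: eq_integral => x _ /=; rewrite /fubini_F fineK//.
by apply: integrable_fin_num => //; exact/bmeas_integrable/bmeas_section.
Qed.

Lemma bmeas_sqmeas_swap (F : T * T -> R) : bmeas F ->
  \int[sqmeas]_p F p = \int[mu]_y \int[mu]_x F (x, y).
Proof.
move=> bF; rewrite /Rintegral -integral21_prod_meas1; last first.
  exact: (bmeas_integrable sqmeas bF).
congr fine; apply: eq_integral => x _ /=; rewrite /fubini_G fineK//.
apply: integrable_fin_num => //; apply: bmeas_integrable.
by apply: (bmeas_comp (u := fun y => (y, x)) _ bF); exact: pair2_measurable.
Qed.

Lemma bmeas_Fubini (F : T * T -> R) : bmeas F ->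
  \int[mu]_x \int[mu]_y F (x, y) = \int[mu]_y \int[mu]_x F (x, y).
Proof. by move=> bF; rewrite -bmeas_sqmeas// bmeas_sqmeas_swap. Qed.

End FubiniBounded.

(** * Bounded measurability in several variables *)

Section BoundedMeasurability.
Context d1 d2 d3 (S : measurableType d1) (T : measurableType d2) (U : measurableType d3).
Variable R : realType.

Lemma measurable_fst_comp (u : S -> T * U) :
  measurable_fun setT u -> measurable_fun setT (fun s => (u s).1).
Proof. by move=> mu; apply: (measurableT_comp _ mu); exact: measurable_fst. Qed.

Lemma measurable_snd_comp (u : S -> T * U) :
  measurable_fun setT u -> measurable_fun setT (fun s => (u s).2).
Proof. by move=> mu; apply: (measurableT_comp _ mu); exact: measurable_snd. Qed.

Lemma bmeas_bfun (f : bfun T R) (u : S -> T) :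
  measurable_fun setT u -> bmeas (fun s => f (u s)).
Proof. by move=> mu; exact: bmeas_comp mu (bfunP f). Qed.

Lemma bmeas_Rintegral2 (mu : {finite_measure set T -> \bar R}) (F : S -> T -> R) :
  bmeas (fun p : S * T => F p.1 p.2) -> bmeas (fun s => \int[mu]_x F s x).
Proof. by move=> bF; exact: (bmeas_Rintegral mu bF). Qed.

End BoundedMeasurability.

Ltac bmeasurable := repeat first
  [ exact: bmeas_cst | exact: measurable_id | exact: measurable_cst
  | exact: measurable_fst | exact: measurable_snd
  | apply: bmeasM | apply: bmeasD | apply: bmeas_bfun
  | apply: bmeas_Rintegral2
  | apply: measurable_fun_pair | apply: measurable_fst_comp
  | apply: measurable_snd_comp ].

(** * The semi-inner product of functions and its seminorm *)

Section Dot.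
Context d (T : measurableType d) (R : realType).
Variable mu : {finite_measure set T -> \bar R}.
Implicit Types f g h : bfun T R.

Definition dot f g : R := \int[mu]_x (f x * g x).

Lemma dotC f g : dot f g = dot g f.
Proof. by apply: eq_Rintegral => x _; rewrite mulrC. Qed.

Lemma dotDl f g h : dot (f + g) h = dot f h + dot g h.
Proof.
rewrite /dot -bmeas_RintegralD; [|by bmeasurable..].
by apply: eq_Rintegral => x _; rewrite bfunDE mulrDl.
Qed.

Lemma dotZl a f g : dot (a *: f) g = a * dot f g.
Proof.
rewrite /dot -bmeas_RintegralZ; last by bmeasurable.
by apply: eq_Rintegral => x _; rewrite bfunZE mulrA.
Qed.

Lemma dot0l f : dot 0 f = 0.
Proof. by rewrite -(scale0r 0) dotZl mul0r. Qed.

Lemma dotNl f g : dot (- f) g = - dot f g.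
Proof. by rewrite -scaleN1r dotZl mulN1r. Qed.

Lemma dotBl f g h : dot (f - g) h = dot f h - dot g h.
Proof. by rewrite dotDl dotNl. Qed.

Lemma dot_suml (I : Type) (r : seq I) (P : pred I) (F : I -> bfun T R) g :
  dot (\sum_(i <- r | P i) F i) g = \sum_(i <- r | P i) dot (F i) g.
Proof. by apply: (big_morph (dot^~ g) (fun x y => dotDl x y g) (dot0l g)). Qed.

Lemma dotDr f g h : dot h (f + g) = dot h f + dot h g.
Proof. by rewrite dotC dotDl !(dotC h). Qed.

Lemma dotZr a f g : dot f (a *: g) = a * dot f g.
Proof. by rewrite dotC dotZl (dotC f). Qed.

Lemma dot0r f : dot f 0 = 0.
Proof. by rewrite dotC dot0l. Qed.

Lemma dotNr f g : dot f (- g) = - dot f g.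
Proof. by rewrite dotC dotNl (dotC f). Qed.

Lemma dotBr f g h : dot h (f - g) = dot h f - dot h g.
Proof. by rewrite dotDr dotNr. Qed.

Lemma dot_sumr (I : Type) (r : seq I) (P : pred I) (F : I -> bfun T R) g :
  dot g (\sum_(i <- r | P i) F i) = \sum_(i <- r | P i) dot g (F i).
Proof. by rewrite dotC dot_suml; apply: eq_bigr => i _; rewrite dotC. Qed.

Lemma dot_ge0 f : 0 <= dot f f.
Proof. by apply: Rintegral_ge0 => x _; rewrite -expr2 sqr_ge0. Qed.

(** Positivity of the quadratic form |a f + b g|^2 in a and b; as [dot] is only semidefinite, a null
    [g] is treated apart. *)
Lemma dot_CauchySchwarz f g : dot f g ^+ 2 <= dot f f * dot g g.
Proof.
have H a b : 0 <= a ^+ 2 * dot f f + 2 * (a * b) * dot f g + b ^+ 2 * dot g g.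
  have := dot_ge0 (a *: f + b *: g).
  rewrite !(dotDl, dotDr, dotZl, dotZr) (dotC g f).
  by move: (dot f f) (dot f g) (dot g g) => x y z; lra.
have ff := dot_ge0 f; have gg := dot_ge0 g.
have [g0|g0] := eqVneq (dot g g) 0.
  have h t : 0 <= dot f f + 2 * t * dot f g.
    by have := H 1 t; rewrite g0 !mulr0 addr0 expr1n !mul1r.
  rewrite g0 mulr0 expr2.
  have [/eqP->|fg0] := boolP (dot f g == 0); first by rewrite mulr0.
  (* At this t the quantity that [h] makes nonnegative equals -1. *)
  have := h (- (dot f f + 1) / (2 * dot f g)).
  have -> : 2 * (- (dot f f + 1) / (2 * dot f g)) * dot f g = - (dot f f + 1).
    by field.
  lra.
(* With these weights the form is <g, g> times the Cauchy-Schwarz defect. *)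
have := H (dot g g) (- dot f g).
have -> : dot g g ^+ 2 * dot f f + 2 * (dot g g * - dot f g) * dot f g +
   (- dot f g) ^+ 2 * dot g g = dot g g * (dot f f * dot g g - dot f g ^+ 2) by ring.
by rewrite pmulr_rge0 ?subr_ge0// lt_neqAle eq_sym g0.
Qed.

(** By Cauchy-Schwarz. This stands in for definiteness: functions are not identified almost
    everywhere, so a null function need not be 0, but [dot] does not see it. *)
Lemma dot_eq0 f g : dot g g = 0 -> dot f g = 0.
Proof.
move=> g0; have := dot_CauchySchwarz f g; rewrite g0 mulr0 => h.
by apply/eqP; rewrite -sqrf_eq0 eq_le h sqr_ge0.
Qed.

Definition norm2 f : R := Num.sqrt (dot f f).

Lemma norm2_ge0 f : 0 <= norm2 f. Proof. exact: sqrtr_ge0. Qed.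

Lemma sqr_norm2 f : norm2 f ^+ 2 = dot f f.
Proof. by rewrite sqr_sqrtr// dot_ge0. Qed.

Lemma dot_le_norm2 f g : `|dot f g| <= norm2 f * norm2 g.
Proof.
rewrite -(ler_pXn2r (n := 2)) ?nnegrE ?mulr_ge0 ?norm2_ge0//.
by rewrite exprMn !sqr_norm2 real_normK ?num_real// dot_CauchySchwarz.
Qed.

Lemma norm2D f g : norm2 (f + g) <= norm2 f + norm2 g.
Proof.
rewrite -(ler_pXn2r (n := 2)) ?nnegrE ?addr_ge0 ?norm2_ge0//.
rewrite sqrrD !sqr_norm2 !(dotDl, dotDr) (dotC g f).
have := dot_le_norm2 f g; rewrite ler_norml => /andP[_].
move: (norm2 f * norm2 g) (dot f g) => a b; rewrite -mulr_natr; lra.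
Qed.

Lemma norm2N f : norm2 (- f) = norm2 f.
Proof. by rewrite /norm2 dotNl dotNr opprK. Qed.

Lemma norm2B f g : norm2 (f - g) <= norm2 f + norm2 g.
Proof. by rewrite -(norm2N g) norm2D. Qed.

Lemma dot_cvg (F : nat -> bfun T R) f M : (forall n x, `|F n x| <= M) ->
  (forall x, F ^~ x @ \oo --> f x) -> (fun n => dot (F n) (F n)) @ \oo --> dot f f.
Proof.
move=> FM Ff; apply: (@bmeas_bounded_cvg _ _ _ _ _ _ (M * M)).
- by move=> n; bmeasurable.
- by bmeasurable.
- by move=> n x; rewrite normrM ler_pM.
- by move=> x; exact: cvgM.
Qed.

End Dot.

(** * Integral kernels: action, composition, transpose and rank one *)

Section Kernels.
Context d (T : measurableType d) (R : realType).
Variable mu : {finite_measure set T -> \bar R}.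
Local Notation V := (bfun T R).
Local Notation W := (bfun (T * T)%type R).
Implicit Types (f g h : V) (K L M : W).
Local Notation dot2 := (dot (sqmeas mu)).

Lemma kapp_subproof K f : bmeas (fun x => \int[mu]_y (K (x, y) * f y)).
Proof. by bmeasurable. Qed.

Definition kapp K f : V := bf (kapp_subproof K f).

Lemma kcomp_subproof K L :
  bmeas (fun p : T * T => \int[mu]_z (K (p.1, z) * L (z, p.2))).
Proof. by bmeasurable. Qed.

Definition kcomp K L : W := bf (kcomp_subproof K L).

Lemma tens_subproof f g : bmeas (fun p : T * T => f p.1 * g p.2).
Proof. by bmeasurable. Qed.

(** Kernel of the rank-one operator h -> <g, h> f. *)
Definition tens f g : W := bf (tens_subproof f g).

Lemma ktr_subproof K : bmeas (fun p : T * T => K (p.2, p.1)).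
Proof. by bmeasurable. Qed.

Definition ktr K : W := bf (ktr_subproof K).

Lemma kcol_subproof K y : bmeas (fun x => K (x, y)).
Proof. by bmeasurable. Qed.

Definition kcol K y : V := bf (kcol_subproof K y).

Lemma kappE K f x : kapp K f x = \int[mu]_y (K (x, y) * f y).
Proof. by []. Qed.

Lemma kcompE K L p : kcomp K L p = \int[mu]_z (K (p.1, z) * L (z, p.2)).
Proof. by []. Qed.

Lemma kappDl K L f : kapp (K + L) f = kapp K f + kapp L f.
Proof.
apply: bfun_ext => x; rewrite bfunDE !kappE -bmeas_RintegralD; [|by bmeasurable..].
by apply: eq_Rintegral => y _; rewrite bfunDE mulrDl.
Qed.

Lemma kappZl a K f : kapp (a *: K) f = a *: kapp K f.
Proof.
apply: bfun_ext => x; rewrite bfunZE !kappE -bmeas_RintegralZ; last by bmeasurable.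
by apply: eq_Rintegral => y _; rewrite bfunZE mulrA.
Qed.

Lemma kappDr K f g : kapp K (f + g) = kapp K f + kapp K g.
Proof.
apply: bfun_ext => x; rewrite bfunDE !kappE -bmeas_RintegralD; [|by bmeasurable..].
by apply: eq_Rintegral => y _; rewrite bfunDE mulrDr.
Qed.

Lemma kappZr a K f : kapp K (a *: f) = a *: kapp K f.
Proof.
apply: bfun_ext => x; rewrite bfunZE !kappE -bmeas_RintegralZ; last by bmeasurable.
by apply: eq_Rintegral => y _; rewrite bfunZE mulrCA.
Qed.

Lemma kapp0l f : kapp 0 f = 0.
Proof. by rewrite -(scale0r 0) kappZl scale0r. Qed.

Lemma kapp0r K : kapp K 0 = 0.
Proof. by rewrite -(scale0r 0) kappZr !scale0r. Qed.

Lemma kappNl K f : kapp (- K) f = - kapp K f.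
Proof. by rewrite -scaleN1r kappZl scaleN1r. Qed.

Lemma kapp_suml (I : Type) (r : seq I) (P : pred I) (F : I -> W) f :
  kapp (\sum_(i <- r | P i) F i) f = \sum_(i <- r | P i) kapp (F i) f.
Proof. by apply: (big_morph (kapp^~ f) (fun x y => kappDl x y f) (kapp0l f)). Qed.

Lemma kapp_sumr (I : Type) (r : seq I) (P : pred I) (F : I -> V) K :
  kapp K (\sum_(i <- r | P i) F i) = \sum_(i <- r | P i) kapp K (F i).
Proof. by apply: (big_morph (kapp K) (fun x y => kappDr K x y) (kapp0r K)). Qed.

Lemma kcompZl a K L : kcomp (a *: K) L = a *: kcomp K L.
Proof.
apply: bfun_ext => x; rewrite bfunZE !kcompE -bmeas_RintegralZ; last by bmeasurable.
by apply: eq_Rintegral => y _; rewrite bfunZE mulrA.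
Qed.

Lemma kcompZr a K L : kcomp K (a *: L) = a *: kcomp K L.
Proof.
apply: bfun_ext => x; rewrite bfunZE !kcompE -bmeas_RintegralZ; last by bmeasurable.
by apply: eq_Rintegral => y _; rewrite bfunZE mulrCA.
Qed.

Lemma kcompDl K L M : kcomp (K + L) M = kcomp K M + kcomp L M.
Proof.
apply: bfun_ext => x; rewrite bfunDE !kcompE -bmeas_RintegralD; [|by bmeasurable..].
by apply: eq_Rintegral => y _; rewrite bfunDE mulrDl.
Qed.

Lemma kcompDr K L M : kcomp M (K + L) = kcomp M K + kcomp M L.
Proof.
apply: bfun_ext => x; rewrite bfunDE !kcompE -bmeas_RintegralD; [|by bmeasurable..].
by apply: eq_Rintegral => y _; rewrite bfunDE mulrDr.
Qed.

Lemma kcompBl K L M : kcomp (K - L) M = kcomp K M - kcomp L M.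
Proof. by rewrite kcompDl -scaleN1r kcompZl scaleN1r. Qed.

Lemma kcompBr K L M : kcomp M (K - L) = kcomp M K - kcomp M L.
Proof. by rewrite kcompDr -scaleN1r kcompZr scaleN1r. Qed.

Lemma kapp_comp K L f : kapp (kcomp K L) f = kapp K (kapp L f).
Proof.
apply: bfun_ext => x /=.
transitivity (\int[mu]_y \int[mu]_z (K (x, z) * L (z, y) * f y)).
  apply: eq_Rintegral => y _; rewrite mulrC -bmeas_RintegralZ; last by bmeasurable.
  by apply: eq_Rintegral => z _; rewrite mulrC.
rewrite (bmeas_Fubini mu (F := fun p => K (x, p.2) * L (p.2, p.1) * f p.1)); last by bmeasurable.
apply: eq_Rintegral => z _ /=; rewrite -bmeas_RintegralZ; last by bmeasurable.
by apply: eq_Rintegral => y _; rewrite mulrA.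
Qed.

Lemma kcol_comp K L y : kcol (kcomp K L) y = kapp K (kcol L y).
Proof. exact: bfun_ext. Qed.

(** Column by column this is [kapp_comp], which spares a second exchange of integrals. *)
Lemma kcompA K L M : kcomp K (kcomp L M) = kcomp (kcomp K L) M.
Proof.
apply: bfun_ext => -[x y]; have := kapp_comp K L (kcol M y).
by move=> /(congr1 (fun f : V => f x)).
Qed.

Lemma kcolZ a K y : kcol (a *: K) y = a *: kcol K y.
Proof. exact: bfun_ext. Qed.

Lemma dot2E K L : dot2 K L = \int[mu]_x \int[mu]_y (K (x, y) * L (x, y)).
Proof. by rewrite /dot bmeas_sqmeas//; bmeasurable. Qed.

Lemma dot2_col K L : dot2 K L = \int[mu]_y dot mu (kcol K y) (kcol L y).
Proof. by rewrite /dot bmeas_sqmeas_swap//; bmeasurable. Qed.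

Lemma dot_tens K f g : dot2 K (tens f g) = dot mu f (kapp K g).
Proof.
rewrite dot2E; apply: eq_Rintegral => x _ /=; rewrite -bmeas_RintegralZ; last by bmeasurable.
by apply: eq_Rintegral => y _; ring.
Qed.

Lemma kapp_tens f g h : kapp (tens f g) h = dot mu g h *: f.
Proof.
apply: bfun_ext => x; rewrite bfunZE /dot mulrC -bmeas_RintegralZ; last by bmeasurable.
by apply: eq_Rintegral => y _ /=; rewrite mulrA.
Qed.

Lemma dot_tens2 f g f' g' : dot2 (tens f g) (tens f' g') = dot mu f f' * dot mu g g'.
Proof. by rewrite dot_tens kapp_tens dotZr (dotC _ f') mulrC. Qed.

Lemma dot_kapp K f g : dot mu (kapp K f) g = dot mu f (kapp (ktr K) g).
Proof.
transitivity (\int[mu]_x \int[mu]_y (K (x, y) * f y * g x)).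
  apply: eq_Rintegral => x _ /=; rewrite mulrC -bmeas_RintegralZ; last by bmeasurable.
  by apply: eq_Rintegral => y _; rewrite mulrC.
rewrite (bmeas_Fubini mu (F := fun p => K (p.1, p.2) * f p.2 * g p.1)); last by bmeasurable.
apply: eq_Rintegral => y _ /=; rewrite -bmeas_RintegralZ; last by bmeasurable.
by apply: eq_Rintegral => x _ /=; ring.
Qed.

(** Composition on the left acts on each column, and the Hilbert-Schmidt product integrates the
    products of columns, so [dot_kapp] applies column by column. *)
Lemma dot_kcomp K L M : dot2 (kcomp K L) M = dot2 L (kcomp (ktr K) M).
Proof.
by rewrite !dot2_col; apply: eq_Rintegral => y _; rewrite !kcol_comp dot_kapp.
Qed.

Lemma ktrD K L : ktr (K + L) = ktr K + ktr L.
Proof. exact: bfun_ext. Qed.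

Lemma ktrZ a K : ktr (a *: K) = a *: ktr K.
Proof. exact: bfun_ext. Qed.

Lemma ktr_tens f g : ktr (tens f g) = tens g f.
Proof. by apply: bfun_ext => x /=; rewrite mulrC. Qed.

(** The entry (x, y) of the composition is the product of row x of [K] and column y of [L];
    Cauchy-Schwarz is applied to it and integrated over x and y. *)
Lemma dot_kcomp_le K L :
  dot2 (kcomp K L) (kcomp K L) <= dot2 K K * dot2 L L.
Proof.
have -> : dot2 K K * dot2 L L = \int[mu]_x \int[mu]_y
    (dot mu (kcol (ktr K) x) (kcol (ktr K) x) * dot mu (kcol L y) (kcol L y)).
  transitivity (\int[mu]_x (dot2 L L * dot mu (kcol (ktr K) x) (kcol (ktr K) x))).
    rewrite bmeas_RintegralZ; last by rewrite /dot; bmeasurable.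
    by rewrite mulrC (dot2E K K).
  apply: eq_Rintegral => x _; rewrite bmeas_RintegralZ; last by rewrite /dot; bmeasurable.
  by rewrite -dot2_col mulrC.
rewrite dot2E; apply: bmeas_le_Rintegral; [by rewrite /dot /=; bmeasurable..|].
move=> x; apply: bmeas_le_Rintegral; [by rewrite /dot /=; bmeasurable..|].
move=> y; rewrite -expr2.
exact: le_trans (dot_CauchySchwarz mu (kcol (ktr K) x) (kcol L y)).
Qed.

(** The entry (x, y) of K L K is the Hilbert-Schmidt product of [L] with the tensor of row x and
    column y of [K], whose norm is bounded independently of x and y. *)
Lemma kcomp3_le K : exists2 C : R, 0 <= C & forall L p,
  `|kcomp K (kcomp L K) p| <= C * norm2 (sqmeas mu) L.
Proof.
have [M M0 KM] := bmeas_bound (bfunP K).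
exists (M ^+ 2 * fine (mu setT)) => [|L [x y]].
  by rewrite mulr_ge0 ?sqr_ge0 ?fine_ge0.
have col_le (K' : W) z : (forall p, `|K' p| <= M) ->
    dot mu (kcol K' z) (kcol K' z) <= M ^+ 2 * fine (mu setT).
  move=> K'M; have := @bmeas_norm_Rintegral _ _ _ mu
    (fun x => kcol K' z x * kcol K' z x) (M ^+ 2).
  move=> H; apply: le_trans (ler_norm _) (H _ _); first by bmeasurable.
  by move=> t; rewrite normrM expr2 ler_pM//; exact: K'M.
have -> : kcomp K (kcomp L K) (x, y) = dot2 L (tens (kcol (ktr K) x) (kcol K y)).
  by rewrite dot_tens.
apply: le_trans (dot_le_norm2 _ _ _) _.
rewrite mulrC ler_wpM2r ?norm2_ge0//.
rewrite -(ler_pXn2r (n := 2)) ?nnegrE ?norm2_ge0 ?mulr_ge0 ?sqr_ge0 ?fine_ge0//.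
rewrite sqr_norm2 dot_tens2 expr2 ler_pM ?dot_ge0 ?col_le// => -[a b].
exact: KM.
Qed.

End Kernels.

(** * Growth rate of a log-convex sequence, and limits of kernels *)

Lemma log_convex_growth (R : realType) (a : nat -> R) :
  (forall n, 0 < a n) -> (forall n, a n.+1 ^+ 2 <= a n * a n.+2) ->
  (forall m n, a (m + n).+1%N <= a m * a n) ->
  exists rho, [/\ 0 < rho, forall n, a n.+1 <= rho * a n & forall n, rho ^+ n.+1 <= a n].
Proof.
move=> a0 logc subm; pose r n := a n.+1 / a n.
have r0 n : 0 < r n by rewrite divr_gt0.
have rS n : r n <= r n.+1.
  by rewrite /r ler_pdivrMr// mulrAC ler_pdivlMr// mulrC -expr2 (le_trans (logc n))// mulrC.
have r_nd : nondecreasing_seq r by exact/nondecreasing_seqP.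
have r_ub n : r n <= a 0 by rewrite /r ler_pdivrMr// mulrC -{1}(addn0 n) subm.
have r_cvg : cvgn r.
  by apply: nondecreasing_is_cvgn => //; exists (a 0) => _ [n _ <-].
have r_le n : r n <= limn r by apply: nondecreasing_cvgn_le.
exists (limn r); split=> [|n|n]; first exact: lt_le_trans (r0 0) (r_le 0).
  by rewrite -ler_pdivrMr// r_le.
(* From index j on the ratios are at least [r j], so r_j^(n+1) a_j <= a_(n+1+j) <= a_n a_j. Dividing
   by a_j and letting j grow gives the lower bound. *)
have rj j : r j ^+ n.+1 <= a n.
  have growth k : r j ^+ k * a j <= a (k + j)%N.
    elim: k => [|k IH]; first by rewrite expr0 mul1r.
    rewrite exprS -mulrA (le_trans (ler_wpM2l (ltW (r0 j)) IH))//.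
    by rewrite addSn -ler_pdivlMr// -/(r _) r_nd// leq_addl.
  by rewrite -(ler_pM2r (a0 j)) (le_trans (growth _))// addSn subm.
have rn_cvg : (fun j => r j ^+ n.+1) @ \oo --> limn r ^+ n.+1.
  elim: n.+1 => [|k IH]; first by under eq_fun do rewrite expr0; exact: cvg_cst.
  by under eq_fun do rewrite exprS; rewrite exprS; exact: cvgM.
by rewrite -(cvg_lim _ rn_cvg)//; apply: limr_le; [exact: cvgP rn_cvg|exact: nearW].
Qed.

Section KernelLimits.
Context d (T : measurableType d) (R : realType).
Variable mu : {finite_measure set T -> \bar R}.
Local Notation W := (bfun (T * T)%type R).

(** The sequence is uniformly Cauchy at rate [e]; its pointwise limit is measurable and inherits the
    common bound. *)
Lemma bfun_lim (F : nat -> W) (B : R) (e : nat -> R) :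
  (forall n p, `|F n p| <= B) -> e @ \oo --> 0 ->
  (forall n m p, (n <= m)%N -> `|F n p - F m p| <= e n) ->
  exists E : W, forall p, F ^~ p @ \oo --> E p.
Proof.
move=> FB e0 Fe.
have Fcvg p : cvgn (F ^~ p).
  apply/cauchy_cvgP/cauchy_exP => eps eps0; have [N _ eN] := cvgr0_norm_lt _ e0 _ eps0.
  exists (F N p); exists N => // n /= Nn; rewrite /ball/=.
  by apply: le_lt_trans (Fe _ _ _ Nn) (le_lt_trans (ler_norm _) (eN _ _)) => /=.
have bE : bmeas (fun p => limn (F ^~ p)).
  split; last first.
    exists B => p; rewrite ler_norml; apply/andP; split.
      by apply: limr_ge => //; apply: nearW => n; have := FB n p; rewrite ler_norml => /andP[].
    by apply: limr_le => //; apply: nearW => n; have := FB n p; rewrite ler_norml => /andP[].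
  apply: (@measurable_fun_cvg _ _ _ setT (fun n p => F n p)) => [n|p _]; last exact: Fcvg.
  exact: (bfunP (F n)).1.
by exists (bf bE).
Qed.

(** Bounded convergence under the integral; the second conclusion restores the uniform bound, so
    that the lemma can be iterated. *)
Lemma kcomp_cvg (K : W) (F : nat -> W) (E : W) B : (forall n p, `|F n p| <= B) ->
  (forall p, F ^~ p @ \oo --> E p) ->
  (forall p, (fun n => kcomp mu K (F n) p) @ \oo --> kcomp mu K E p) /\
  exists B', forall n p, `|kcomp mu K (F n) p| <= B'.
Proof.
move=> FB FE; have [M M0 KM] := bmeas_bound (bfunP K); split=> [p|].
  apply: (@bmeas_bounded_cvg _ _ _ _ _ _ (M * B)).
  - by move=> n; bmeasurable.
  - by bmeasurable.
  - by move=> n x; rewrite normrM ler_pM.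
  - by move=> x; apply: cvgM => //; exact: cvg_cst.
exists (M * B * fine (mu setT)) => n p; apply: bmeas_norm_Rintegral.
  by bmeasurable.
by move=> x; rewrite normrM ler_pM.
Qed.

End KernelLimits.

(** * An eigenvector of a symmetric kernel, by Schwarz's constants *)

Section TopEigenvalue.
Context d (T : measurableType d) (R : realType).
Variable mu : {finite_measure set T -> \bar R}.
Local Notation V := (bfun T R).
Local Notation W := (bfun (T * T)%type R).
Local Notation dot2 := (dot (sqmeas mu)).
Local Notation "K ** L" := (kcomp mu K L) (at level 40, left associativity).
Variable K : W.
Hypothesis K_sym : ktr K = K.

(** The exponent is shifted: [kpow n] is K^(n+1), since the identity has in general no kernel. *)
Definition kpow n : W := iter n (kcomp mu K) K.

Lemma kpowS n : kpow n.+1 = K ** kpow n. Proof. by []. Qed.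

Lemma kpowD m n : kpow m ** kpow n = kpow (m + n).+1.
Proof.
by elim: m => [|m IH]; rewrite ?add0n// kpowS -kcompA IH addSn.
Qed.

Lemma kpowSr n : kpow n.+1 = kpow n ** K.
Proof. by rewrite (kpowD n 0) addn0. Qed.

(** Symmetry moves factors [K] from one side of the product to the other. *)
Lemma dot_kpow i j k l : (i + j = k + l)%N ->
  dot2 (kpow i) (kpow j) = dot2 (kpow k) (kpow l).
Proof.
have dot0 m n : dot2 (kpow m) (kpow n) = dot2 K (kpow (m + n)).
  elim: m n => [//|m IH] n.
  by rewrite kpowS dot_kcomp K_sym -kpowS IH addnS addSn.
by move=> ijkl; rewrite !dot0 ijkl.
Qed.

Lemma kpow_log_convex n : dot2 (kpow n.+1) (kpow n.+1) ^+ 2 <=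
  dot2 (kpow n) (kpow n) * dot2 (kpow n.+2) (kpow n.+2).
Proof.
have := dot_CauchySchwarz (sqmeas mu) (kpow n) (kpow n.+2).
by rewrite (@dot_kpow n n.+2 n.+1 n.+1)// addnS addSn.
Qed.

Lemma kpow_submul m n : dot2 (kpow (m + n).+1) (kpow (m + n).+1) <=
  dot2 (kpow m) (kpow m) * dot2 (kpow n) (kpow n).
Proof. by rewrite -kpowD dot_kcomp_le. Qed.

Hypothesis K2_neq0 : 0 < dot2 (K ** K) (K ** K).

(** By log-convexity a positive term has positive neighbours on both sides; the hypothesis on K^2
    starts the induction at index 1. *)
Lemma kpow_gt0 n : 0 < dot2 (kpow n) (kpow n).
Proof.
have gt0 k : 0 < dot2 (kpow k.+1) (kpow k.+1) ->
    0 < dot2 (kpow k) (kpow k) /\ 0 < dot2 (kpow k.+2) (kpow k.+2).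
  move=> k0; have := kpow_log_convex k; have := exprn_gt0 2 k0.
  move=> /lt_le_trans/[apply]; rewrite !lt_neqAle !dot_ge0 !andbT !(eq_sym 0).
  by rewrite mulf_eq0 negb_or => /andP[/andP[-> ->] _].
have : 0 < dot2 (kpow n.+1) (kpow n.+1).
  by elim: n => [//|n /gt0[]].
by move/gt0 => -[].
Qed.

(* The numbers a n = |K^(n+1)|^2 are log-convex and submultiplicative, so the
   ratios a n.+1 / a n increase to a limit rho with a n / rho^(n+1) decreasing
   and at least 1.  Since <K^i, K^j> only depends on i + j, this makes
   K^(2n+2) / rho^(n+1) a Cauchy sequence; composing with [K] on both sides
   upgrades Hilbert-Schmidt to uniform convergence. *)
Lemma top_kernel : exists (rho : R) (E : W), [/\ 0 < rho,
  dot2 (K ** K) (K ** K) <= rho * dot2 K K,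
  K ** (K ** E) = rho *: E & 0 < dot2 E E].
Proof.
have [rho [rho0 rho_ub rho_lb]] := log_convex_growth kpow_gt0 kpow_log_convex kpow_submul.
pose a n := dot2 (kpow n) (kpow n).
pose b n := a n / rho ^+ n.+1.
have rhoX n : 0 < rho ^+ n by exact: exprn_gt0.
have b1 n : 1 <= b n by rewrite /b ler_pdivlMr// mul1r rho_lb.
have bS n : b n.+1 <= b n.
  rewrite /b ler_pdivrMr// (exprS _ n.+1) mulrCA -mulrA mulVf ?mulr1 ?gt_eqF//.
  exact: rho_ub.
have b_ni : nonincreasing_seq b by exact/nonincreasing_seqP.
have b_cvg : cvgn b.
  by apply: nonincreasing_is_cvgn => //; exists 1 => _ [n _ <-].
have b_ge n : limn b <= b n by apply: nonincreasing_cvgn_ge.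
pose E n : W := (rho ^+ n.+1)^-1 *: kpow (n + n).+1.
have dotE n m : dot2 (E n) (E m) = b (n + m).+1%N.
  rewrite dotZl dotZr /b /a.
  rewrite (@dot_kpow _ _ (n + m).+1 (n + m).+1); last by lia.
  have -> : (n + m).+2 = (n.+1 + m.+1)%N by lia.
  by rewrite exprD invfM mulrA mulrC.
(* This exhibits [E n.+1] as a sandwich to which [kcomp3_le] applies; hence the shifted index
   below. *)
have ES n : E n.+1 = rho^-1 *: (K ** (E n ** K)).
  rewrite /E kcompZl kcompZr -kpowSr -kpowS scalerA -invfM -exprS.
  by rewrite addSn addnS.
have rV0 : 0 <= rho^-1 by rewrite invr_ge0 ltW.
have [C C0 KC] := kcomp3_le mu K.
have Ebound n p : `|E n.+1 p| <= rho^-1 * (C * Num.sqrt (b 0)).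
  rewrite ES bfunZE normrM gtr0_norm ?invr_gt0// ler_wpM2l//.
  apply: le_trans (KC _ _) _; rewrite ler_wpM2l// /norm2 dotE ler_wsqrtr//.
  exact: b_ni.
pose e n := rho^-1 * (C * Num.sqrt (2 * (b n - limn b))).
have e0 : e @ \oo --> 0.
  have b0 : (fun n => Num.sqrt (2 * (b n - limn b))) @ \oo --> (0 : R).
    rewrite -(@sqrtr0 R); apply: continuous_cvg; first exact: sqrt_continuous.
    rewrite -(mulr0 2) -(subrr (limn b)); apply: cvgM; first exact: cvg_cst.
    by apply: cvgB => //; exact: cvg_cst.
  rewrite -(mulr0 rho^-1) -(mulr0 C); apply: cvgM; first exact: cvg_cst.
  by apply: cvgM => //; exact: cvg_cst.
have Ecauchy n m p : (n <= m)%N -> `|E n.+1 p - E m.+1 p| <= e n.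
  move=> nm; rewrite !ES !bfunZE -mulrBr normrM gtr0_norm ?invr_gt0//.
  rewrite ler_wpM2l//.
  have -> : (K ** (E n ** K)) p - (K ** (E m ** K)) p =
      (K ** ((E n - E m) ** K)) p by rewrite kcompBl kcompBr.
  apply: le_trans (KC _ _) _; rewrite ler_wpM2l// /norm2 ler_wsqrtr//.
  rewrite dotBl !dotBr !dotE (addnC m n).
  have := b_ge (n + m).+1; have : b (n + n).+1%N <= b n by apply: b_ni; lia.
  have : b (m + m).+1%N <= b n by apply: b_ni; lia.
  lra.
have [F EF] := bfun_lim (fun n p => Ebound n p) e0 Ecauchy.
have [KE [B KEB]] := kcomp_cvg mu K (fun n p => Ebound n p) EF.
have [KKE _] := kcomp_cvg mu K KEB KE.
exists rho, F; split => //.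
- exact: rho_ub 0.
- apply: bfun_ext => p; have := KKE p.
  have -> : (fun n => (K ** (K ** E n.+1)) p) = (fun n => rho * E n.+2 p).
    apply/funext => n; rewrite /E !kcompZr -!kpowS !bfunZE.
    rewrite (_ : (n.+1 + n.+1).+3 = (n.+2 + n.+2).+1)%N; last by lia.
    rewrite (exprS _ n.+2) mulrA; congr (_ * _).
    by have := rhoX n.+2; move: (rho ^+ n.+2) => X X0; field; rewrite !gt_eqF.
  move=> h; have h' : (fun n => rho * E n.+2 p) @ \oo --> rho * F p.
    by apply: cvgM; [exact: cvg_cst|rewrite (cvg_shiftS (fun n => E n.+1 p)); exact: EF].
  by rewrite bfunZE -(cvg_lim _ h)// (cvg_lim _ h').
- apply: lt_le_trans ltr01 _.
  have h := @dot_cvg _ _ _ (sqmeas mu) (fun n => E n.+1) F _ Ebound EF; rewrite -(cvg_lim _ h)//.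
  by apply: limr_ge; [exact: cvgP h|apply: nearW => n; rewrite dotE].
Qed.

(** A non-null column h of the kernel from [top_kernel] satisfies K^2 h = rho h. With s^2 = rho, K h
    + s h and K h - s h are eigenvectors for s and -s unless null, and they are not both null since
    they differ by 2 s h. *)
Lemma sym_kernel_eigenvector : exists (t : R) (g : V), [/\ t != 0,
  0 < dot mu g g, kapp mu K g = t *: g &
  dot2 (K ** K) (K ** K) <= t ^+ 2 * dot2 K K].
Proof.
have [rho [E [rho0 rho_ub KKE E0]]] := top_kernel.
have [y y0] : exists y, 0 < dot mu (kcol E y) (kcol E y).
  apply/not_existsP => y0; move: E0; rewrite dot2_col.
  rewrite (@eq_Rintegral _ _ _ mu setT (fun=> 0)) ?Rintegral_cst// ?mul0r ?ltxx//.
  by move=> y _; apply/eqP; rewrite eq_le dot_ge0 andbT leNgt; exact/negP.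
set h := kcol E y in y0.
have KKh : kapp mu K (kapp mu K h) = rho *: h.
  by rewrite -kcolZ -KKE !kcol_comp.
pose s := Num.sqrt rho.
have s0 : 0 < s by rewrite sqrtr_gt0.
have ss : s * s = rho by rewrite -expr2 sqr_sqrtr// ltW.
have eig (t : R) : t * t = rho -> kapp mu K (kapp mu K h + t *: h) = t *: (kapp mu K h + t *: h).
  by move=> tt; rewrite kappDr kappZr KKh scalerDr scalerA tt addrC.
have [g1|g1] := eqVneq (dot mu (kapp mu K h + s *: h) (kapp mu K h + s *: h)) 0; last first.
  exists s, (kapp mu K h + s *: h); split => //; rewrite ?gt_eqF//.
  - by rewrite lt_neqAle eq_sym g1 dot_ge0.
  - exact: eig.
  - by rewrite expr2 ss.
exists (- s), (kapp mu K h + (- s) *: h); split => //.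
- by rewrite oppr_eq0 gt_eqF.
- rewrite lt_neqAle dot_ge0 andbT eq_sym; apply/eqP => g2.
  have := dot_eq0 (kapp mu K h + s *: h) g2; move: g1 g2.
  rewrite !(dotDl, dotDr, dotZl, dotZr) (dotC mu h).
  have := mulr_gt0 (mulr_gt0 s0 s0) y0.
  move: (dot mu h h) (dot mu _ h) (dot mu (kapp mu K h) _) => x z w; lra.
- by apply: eig; rewrite mulrNN.
- by rewrite sqrrN expr2 ss.
Qed.

End TopEigenvalue.

(** * Rearrangement inequality for substochastic weights *)

Section Rearrangement.
Variable R : realType.
Implicit Types a b x y : nat -> R.

(** Summation by parts: the nonnegative decrements of [a] multiply the partial sums. *)
Lemma sum_majorized a x y n : nonincreasing_seq a -> (forall i, 0 <= a i) ->
  (forall k, (k <= n)%N -> \sum_(i < k) x i <= \sum_(i < k) y i) ->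
  \sum_(i < n) a i * x i <= \sum_(i < n) a i * y i.
Proof.
move=> a_ni a0 xy; rewrite -subr_ge0 -sumrB.
(* The induction carries the boundary term of the summation by parts. *)
suff : a n * (\sum_(i < n) y i - \sum_(i < n) x i) <=
    \sum_(i < n) (a i * y i - a i * x i).
  by apply: le_trans; rewrite mulr_ge0 ?subr_ge0 ?xy.
elim: n xy => [|n IH] xy; first by rewrite !big_ord0 subrr mulr0.
rewrite !big_ord_recr /=.
have {}IH := IH (fun k kn => xy k (leqW kn)).
have := xy n.+1 (leqnn _); rewrite !big_ord_recr /=.
have an := a_ni _ _ (leqnSn n); have := a0 n.+1.
move: IH; move: (a n) (a n.+1) an (x n) (y n) => u v vu p q.
move: (\sum_(i < n) (_ - _)) (\sum_(i < n) y i) (\sum_(i < n) x i) => S Y X.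
move=> S_ge v0 XY; apply: (@le_trans _ _ (u * (Y + q - (X + p)))); last lra.
by rewrite ler_wpM2r// subr_ge0.
Qed.

(** Two summations by parts, one for [a] and one for [b], leave only the total of a k by l block of
    [w], which is at most min(k, l) by the row and column bounds. *)
Lemma rearrangement_substochastic a b (w : nat -> nat -> R) n :
  nonincreasing_seq a -> (forall i, 0 <= a i) ->
  nonincreasing_seq b -> (forall i, 0 <= b i) ->
  (forall i j, 0 <= w i j) ->
  (forall i m, \sum_(j < m) w i j <= 1) -> (forall j m, \sum_(i < m) w i j <= 1) ->
  \sum_(i < n) a i * (\sum_(j < n) b j * w i j) <= \sum_(i < n) a i * b i.
Proof.
move=> a_ni a0 b_ni b0 w0 row col.
apply: (sum_majorized (x := fun i => \sum_(j < n) b j * w i j)) => // k kn.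
rewrite exchange_big /=.
rewrite (eq_bigr (fun j : 'I_n => b j * \sum_(i < k) w i j)); last first.
  by move=> j _; rewrite mulr_sumr.
(* The first k terms become n terms with weights 0 and 1, to be compared with the partial column
   sums of [w]. *)
have -> : \sum_(i < k) b i = \sum_(i < n) b i * (i < k)%N%:R.
  rewrite (big_ord_widen n (fun i => b i) kn) big_mkcond /=.
  by apply: eq_bigr => i _; case: ifP => _; rewrite ?mulr1 ?mulr0.
apply: (sum_majorized (x := fun j => \sum_(i < k) w i j) (y := fun i => (i < k)%N%:R)) => // l ln.
have sumE : \sum_(i < l) (i < k)%N%:R = (minn l k)%:R :> R.
  elim: l {ln} => [|l IH]; first by rewrite big_ord0 min0n.
  by rewrite big_ord_recr /= IH -natrD; congr (_%:R); case: ltnP; lia.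
rewrite sumE; case: (leqP l k) => lk.
  apply: (@le_trans _ _ (\sum_(j < l) 1)); last by rewrite sumr_const card_ord.
  by apply: ler_sum => j _; exact: col.
rewrite exchange_big /=; apply: (@le_trans _ _ (\sum_(j < k) 1)); last by rewrite sumr_const card_ord.
by apply: ler_sum => j _; exact: row.
Qed.

End Rearrangement.

(** * Spectral expansion of a symmetric kernel, and the Hoffman-Wielandt inequality *)

Section EigenSystems.
Context d (T : measurableType d) (R : realType).
Variable mu : {finite_measure set T -> \bar R}.
Local Notation V := (bfun T R).
Local Notation W := (bfun (T * T)%type R).
Local Notation dot2 := (dot (sqmeas mu)).
Local Notation "K ** L" := (kcomp mu K L) (at level 40, left associativity).

(* A finitely supported list of eigenvalues is continued by zeros, to which
   the zero function is attached. *)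
Definition orthosys (lam : nat -> R) (f : nat -> V) :=
  forall i j, dot mu (f i) (f j) = ((i == j) && (lam i != 0))%:R.

Definition kres (K : W) (lam : nat -> R) (f : nat -> V) m : W :=
  K - \sum_(i < m) lam i *: tens (f i) (f i).

(** Absorbs the padding: the squared norm of [f i] is 1 unless [lam i] is 0. *)
Lemma orthosys_mul lam f i : orthosys lam f -> lam i * dot mu (f i) (f i) = lam i.
Proof. by move=> ->; rewrite eqxx; case: eqVneq => [->|_]; rewrite ?mul0r ?mulr1. Qed.

Lemma orthosys_sum lam f (c : nat -> R) m (j : 'I_m) : orthosys lam f ->
  \sum_(i < m) c i * dot mu (f i) (f j) = c j * dot mu (f j) (f j).
Proof.
move=> ortho; rewrite (bigD1 j)//= big1 ?addr0// => i ij.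
by rewrite ortho -val_eqE/= in ij *; rewrite (negbTE ij) mulr0.
Qed.

Lemma Bessel lam f (g : V) n : orthosys lam f ->
  \sum_(i < n) dot mu g (f i) ^+ 2 <= dot mu g g.
Proof.
move=> ortho; pose c i := dot mu g (f i).
(* A padding function is null, so its coefficient vanishes as well. *)
have cE i : c i * dot mu (f i) (f i) = c i.
  rewrite /c; have := ortho i i; rewrite eqxx /=; case: (lam i != 0) => h.
    by rewrite h mulr1.
  by rewrite (dot_eq0 g h) mul0r.
have := dot_ge0 mu (g - \sum_(i < n) c i *: f i).
rewrite dotBl !dotBr dot_suml !dot_sumr.
under eq_bigr do rewrite dotZr -expr2.
under [X in _ - (X - _)]eq_bigr do rewrite dotZl (dotC mu _ g) -expr2.
suff -> : \sum_(i < n) dot mu (\sum_(i0 < n) c i0 *: f i0) (c i *: f i) = \sum_(i < n) c i ^+ 2.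
  by rewrite subrr subr0 subr_ge0.
apply: eq_bigr => i _; rewrite dotZr dot_suml.
by under eq_bigr do rewrite dotZl; rewrite (orthosys_sum c _ ortho) cE expr2.
Qed.

Section Residual.
Variables (K : W) (lam : nat -> R) (f : nat -> V).
Hypothesis K_sym : ktr K = K.
Hypothesis lam_ni : nonincreasing_seq lam.
Hypothesis lam_ge0 : forall i, 0 <= lam i.
Hypothesis ortho : orthosys lam f.
Hypothesis eig : forall i, kapp mu K (f i) = lam i *: f i.

Lemma kapp_tens_sum m (g : V) : kapp mu (\sum_(i < m) lam i *: tens (f i) (f i)) g =
  \sum_(i < m) (lam i * dot mu (f i) g) *: f i.
Proof.
by rewrite kapp_suml; apply: eq_bigr => i _; rewrite kappZl kapp_tens scalerA.
Qed.

Lemma kres_eigenvector m (j : 'I_m) : kapp mu (kres K lam f m) (f j) = 0.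
Proof.
rewrite kappDl kappNl eig kapp_tens_sum (bigD1 j)//= big1 ?addr0.
  by rewrite orthosys_mul// subrr.
by move=> i ij; rewrite ortho -val_eqE/= in ij *; rewrite (negbTE ij) mulr0 scale0r.
Qed.

Lemma ktr_kres m : ktr (kres K lam f m) = kres K lam f m.
Proof.
rewrite /kres ktrD -scaleN1r ktrZ !scaleN1r K_sym; congr (_ - _).
elim/big_ind: _ => [|x y xE yE|i _]; first exact: bfun_ext.
  by rewrite ktrD xE yE.
by rewrite ktrZ ktr_tens.
Qed.

(** The subtracted tensors are orthogonal to the residual, which annihilates the removed
    eigenvectors. *)
Lemma dot_kres m : dot2 (kres K lam f m) (kres K lam f m) = dot2 (kres K lam f m) K.
Proof.
rewrite {2}/kres dotBr dot_sumr big1 ?subr0// => i _.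
by rewrite dotZr dot_tens kres_eigenvector dot0r mulr0.
Qed.

Lemma dot_kres_sum m :
  dot2 (kres K lam f m) (kres K lam f m) = dot2 K K - \sum_(i < m) lam i ^+ 2.
Proof.
rewrite dot_kres dotBl dot_suml; congr (_ - _); apply: eq_bigr => i _.
by rewrite dotZl dotC dot_tens eig dotZr orthosys_mul// expr2.
Qed.

Lemma eigenvalue_sum_le m : \sum_(i < m) lam i ^+ 2 <= dot2 K K.
Proof. by rewrite -subr_ge0 -dot_kres_sum dot_ge0. Qed.

Lemma kres_le m : norm2 (sqmeas mu) (kres K lam f m) <= norm2 (sqmeas mu) K.
Proof.
rewrite /norm2 ler_wsqrtr// dot_kres_sum gerBl sumr_ge0// => i _.
exact: sqr_ge0.
Qed.

(** The sequence is nonincreasing, so (m+1) lam_m^2 is at most the sum of the first m+1 squares,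
    hence at most |K|^2. *)
Lemma eigenvalue_cvg0 : lam @ \oo --> 0.
Proof.
have sq m : lam m ^+ 2 <= dot2 K K * m.+1%:R^-1.
  rewrite ler_pdivlMr// (le_trans _ (eigenvalue_sum_le m.+1))//.
  rewrite mulr_natr -[X in _ *+ X](card_ord m.+1) -sumr_const ler_sum// => i _.
  by rewrite ler_pXn2r ?nnegrE// lam_ni// -ltnS.
have sq0 : (fun m => lam m ^+ 2) @ \oo --> 0.
  apply: (@squeeze_cvgr _ _ _ _ (fun=> 0) (fun m => dot2 K K * m.+1%:R^-1)).
  - by apply: nearW => m; rewrite sqr_ge0 sq.
  - exact: cvg_cst.
  - rewrite -(mulr0 (dot2 K K)); apply: cvgM; first exact: cvg_cst.
    exact: cvg_harmonic.
rewrite (_ : lam = fun m => Num.sqrt (lam m ^+ 2)); last first.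
  by apply/funext => m; rewrite sqrtr_sqr ger0_norm.
rewrite -(@sqrtr0 R); apply: continuous_cvg => //; exact: sqrt_continuous.
Qed.

Hypothesis complete : forall (t : R) (g : V), t != 0 -> kapp mu K g = t *: g ->
  (forall i, dot mu g (f i) = 0) -> dot mu g g = 0.

(* Every eigenvector of the residual is an eigenvector of [K] orthogonal to
   [f 0, ..., f m.-1], so its eigenvalue is at most [lam m]. *)
Lemma kres_sqr_le m :
  norm2 (sqmeas mu) (kres K lam f m ** kres K lam f m) <= lam m * norm2 (sqmeas mu) K.
Proof.
set Q := kres K lam f m; rewrite -(ler_pXn2r (n := 2)) ?nnegrE ?mulr_ge0 ?norm2_ge0//.
rewrite exprMn !sqr_norm2.
have [Q0|Q0] := eqVneq (dot2 (Q ** Q) (Q ** Q)) 0.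
  by rewrite Q0 mulr_ge0 ?sqr_ge0 ?dot_ge0.
have Q_gt0 : 0 < dot2 (Q ** Q) (Q ** Q) by rewrite lt_neqAle eq_sym Q0 dot_ge0.
have [t [g [t0 g0 Qg le_t]]] := sym_kernel_eigenvector (ktr_kres m) Q_gt0.
have g_perp (i : 'I_m) : dot mu g (f i) = 0.
  have : t * dot mu g (f i) = 0.
    by rewrite -dotZl -Qg dot_kapp ktr_kres kres_eigenvector dot0r.
  by move/eqP; rewrite mulf_eq0 (negbTE t0) => /eqP.
have Kg : kapp mu K g = t *: g.
  rewrite -Qg kappDl kappNl kapp_tens_sum big1 ?subr0// => i _.
  by rewrite dotC g_perp mulr0 scale0r.
have [i gi] : exists i, dot mu g (f i) != 0.
  apply: contrapT => h; move: g0; rewrite (complete t0 Kg) ?ltxx// => i.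
  by apply/eqP/negPn/negP => gi; apply: h; exists i.
have tE : t = lam i.
  have := dot_kapp mu K g (f i); rewrite K_sym eig Kg dotZl dotZr.
  by move/(mulIf gi).
have mi : (m <= i)%N.
  by rewrite leqNgt; apply: contra gi => im; rewrite (g_perp (Ordinal im)).
apply: le_trans le_t _; apply: ler_pM; rewrite ?sqr_ge0 ?dot_ge0//.
  by rewrite tE ler_pXn2r ?nnegrE// lam_ni.
by rewrite -!sqr_norm2 ler_pXn2r ?nnegrE ?norm2_ge0// kres_le.
Qed.

(** For the residual Q, |Q|^2 = <Q, K>. Replacing [K] by a finite-rank kernel costs little because
    |Q| <= |K|. Against a tensor, <Q, tens u v> = <u, Q v>, and |Q v|^2 = <v, Q^2 v> <= |Q^2| |v|^2
    tends to 0 by [kres_sqr_le]. *)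
Lemma kres_cvg0 : (forall eps, 0 < eps -> exists n (u v : 'I_n -> V),
    norm2 (sqmeas mu) (K - \sum_(i < n) tens (u i) (v i)) <= eps) ->
  (fun m => norm2 (sqmeas mu) (kres K lam f m)) @ \oo --> 0.
Proof.
move=> frank; pose N := norm2 (sqmeas mu) K.
have N0 : 0 <= N by exact: norm2_ge0.
suff cvg0 : (fun m => dot2 (kres K lam f m) (kres K lam f m)) @ \oo --> 0.
  by rewrite -(@sqrtr0 R); apply: continuous_cvg => //; exact: sqrt_continuous.
apply/cvgr0Pnorm_le => eps eps0.
(* The denominator N + 1 stays positive even if the norm of [K] is 0. *)
have [|n [u [v uvK]]] := frank (eps / 2 / (N + 1)).
  by rewrite !divr_gt0// ltr_wpDl.
pose S := \sum_(i < n) norm2 mu (u i) * Num.sqrt (N * dot mu (v i) (v i)).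
have S0 : 0 <= S by apply: sumr_ge0 => i _; rewrite mulr_ge0 ?norm2_ge0 ?sqrtr_ge0.
have bound m : dot2 (kres K lam f m) (kres K lam f m) <= eps / 2 + Num.sqrt (lam m) * S.
  set Q := kres K lam f m.
  rewrite dot_kres -/Q -{1}(subrK (\sum_(i < n) tens (u i) (v i)) K) dotDr.
  apply: lerD.
    apply: le_trans (ler_norm _) (le_trans (dot_le_norm2 _ _ _) _).
    apply: (@le_trans _ _ (N * (eps / 2 / (N + 1)))).
      by apply: ler_pM; rewrite ?norm2_ge0// kres_le.
    rewrite mulrA ler_pdivrMr ?ltr_wpDl// mulrC ler_wpM2l ?divr_ge0 ?(ltW eps0)//.
    by rewrite lerDl.
  rewrite dot_sumr mulr_sumr; apply: ler_sum => i _; rewrite dot_tens.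
  apply: le_trans (ler_norm _) (le_trans (dot_le_norm2 _ _ _) _).
  rewrite mulrCA ler_wpM2l ?norm2_ge0// -sqrtrM// ler_wsqrtr//.
  rewrite dot_kapp ktr_kres -/Q -kapp_comp -dot_tens.
  apply: le_trans (ler_norm _) (le_trans (dot_le_norm2 _ _ _) _).
  rewrite mulrA; apply: ler_pM; rewrite ?norm2_ge0 ?kres_sqr_le//.
  by rewrite /norm2 dot_tens2 -expr2 sqrtr_sqr ger0_norm ?dot_ge0.
have sl : (fun m => Num.sqrt (lam m) * S) @ \oo --> 0.
  rewrite -(mul0r S); apply: cvgM; last exact: cvg_cst.
  rewrite -(@sqrtr0 R); apply: continuous_cvg; first exact: sqrt_continuous.
  exact: eigenvalue_cvg0.
have e20 : 0 < eps / 2 by rewrite divr_gt0.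
have /cvgr0Pnorm_le/(_ _ e20)[M _ Mn] := sl.
exists M => // m /= /Mn /=; rewrite !ger0_norm ?dot_ge0 ?mulr_ge0 ?sqrtr_ge0// => h.
by apply: le_trans (bound m) _; lra.
Qed.

End Residual.

(** The inequality is first proved for the truncations [A m] and [B m], where all sums are finite;
    then m tends to infinity with [n] fixed and the residuals vanish. *)
Lemma Hoffman_Wielandt (K L : W) (a b : nat -> R) (e f : nat -> V) n :
  nonincreasing_seq a -> (forall i, 0 <= a i) ->
  nonincreasing_seq b -> (forall i, 0 <= b i) ->
  orthosys a e -> orthosys b f ->
  (fun m => norm2 (sqmeas mu) (kres K a e m)) @ \oo --> 0 ->
  (fun m => norm2 (sqmeas mu) (kres L b f m)) @ \oo --> 0 ->
  \sum_(i < n) (a i - b i) ^+ 2 <= dot2 (K - L) (K - L).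
Proof.
move=> a_ni a0 b_ni b0 orthoe orthof resK resL.
pose A m : W := \sum_(i < m) a i *: tens (e i) (e i).
pose B m : W := \sum_(i < m) b i *: tens (f i) (f i).
have sqE (c : nat -> R) (g : nat -> V) m : orthosys c g ->
    dot2 (\sum_(i < m) c i *: tens (g i) (g i)) (\sum_(i < m) c i *: tens (g i) (g i)) =
    \sum_(i < m) c i ^+ 2.
  move=> ortho; rewrite dot_sumr; apply: eq_bigr => j _; rewrite dotZr dot_tens.
  rewrite kapp_tens_sum (bigD1 j)//= big1 ?addr0.
    by rewrite orthosys_mul// dotZr orthosys_mul// expr2.
  by move=> i ij; rewrite ortho -val_eqE/= in ij *; rewrite (negbTE ij) mulr0 scale0r.
have cross m : dot2 (A m) (B m) <= \sum_(i < m) a i * b i.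
  have -> : dot2 (A m) (B m) =
      \sum_(i < m) a i * (\sum_(j < m) b j * dot mu (e i) (f j) ^+ 2).
    rewrite dot_suml; apply: eq_bigr => i _; rewrite dotZl dot_sumr; congr (_ * _).
    by apply: eq_bigr => j _; rewrite dotZr dot_tens2 expr2.
  apply: (rearrangement_substochastic (w := fun i j => dot mu (e i) (f j) ^+ 2)) => //.
  - by move=> i j; exact: sqr_ge0.
  - move=> i k; apply: le_trans (Bessel (e i) k orthof) _.
    by rewrite orthoe eqxx; case: (a i != 0); rewrite ?ler01.
  - move=> j k; under eq_bigr do rewrite dotC.
    apply: le_trans (Bessel (f j) k orthoe) _.
    by rewrite orthof eqxx; case: (b j != 0); rewrite ?ler01.
have AB m : \sum_(i < m) (a i - b i) ^+ 2 <= norm2 (sqmeas mu) (A m - B m) ^+ 2.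
  rewrite sqr_norm2 dotBl !dotBr (dotC _ (B m)) !sqE//.
  under eq_bigr do rewrite sqrrB.
  rewrite big_split /= sumrB sumrMnl.
  have := cross m; move: (\sum_(i < m) a i * b i) => z; lra.
(* Truncation can increase |K - L| by at most the norms of the two residuals. *)
have nonexp m : norm2 (sqmeas mu) (A m - B m) <=
    norm2 (sqmeas mu) (K - L) + norm2 (sqmeas mu) (kres K a e m) + norm2 (sqmeas mu) (kres L b f m).
  have -> : A m - B m = K - L - kres K a e m + kres L b f m.
    by rewrite /kres -/(A m) -/(B m) !opprB; apply/eqP; rewrite -subr_eq0; apply/eqP/bfun_ext => x;
      rewrite !(bfunDE, bfunNE) bfun0E; ring.
  apply: le_trans (norm2D _ _ _) _; rewrite lerD2r; exact: norm2B.
have lim : (fun m => (norm2 (sqmeas mu) (K - L) + norm2 (sqmeas mu) (kres K a e m) +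
    norm2 (sqmeas mu) (kres L b f m)) ^+ 2) @ \oo --> dot2 (K - L) (K - L).
  rewrite -sqr_norm2 -{2}(addr0 (norm2 _ _)) -{2}(addr0 (norm2 _ _)) expr2.
  under eq_fun do rewrite expr2.
  have h : (fun m => norm2 (sqmeas mu) (K - L) + norm2 (sqmeas mu) (kres K a e m) +
    norm2 (sqmeas mu) (kres L b f m)) @ \oo --> norm2 (sqmeas mu) (K - L) + 0 + 0.
    by apply: cvgD => //; apply: cvgD => //; exact: cvg_cst.
  exact: cvgM.
rewrite -(cvg_lim _ lim)//; apply: limr_ge; first exact: cvgP lim.
exists n => // m /= nm; apply: (@le_trans _ _ (\sum_(i < m) (a i - b i) ^+ 2)).
  rewrite (big_ord_widen m (fun i => (a i - b i) ^+ 2) nm) big_mkcond /= ler_sum// => i _.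
  by case: ifP => _ //; exact: sqr_ge0.
apply: le_trans (AB m) _; rewrite ler_pXn2r ?nnegrE ?norm2_ge0 ?nonexp//.
exact: le_trans (norm2_ge0 _ _) (nonexp m).
Qed.

End EigenSystems.

(** * Orthonormal eigenvectors assembled from bases of the eigenspaces *)

Section EigenvectorFamily.
Context d (T : measurableType d) (R : realType).
Variable mu : {finite_measure set T -> \bar R}.
Local Notation V := (bfun T R).
Local Notation W := (bfun (T * T)%type R).

Lemma left_kernel_neq0 m n (M : 'M[R]_(m, n)) : (n < m)%N ->
  exists2 u : 'rV_m, u != 0 & u *m M = 0.
Proof.
move=> nm; have : kermx M != 0.
  by rewrite kermx_eq0 /row_free neq_ltn (leq_ltn_trans (rank_leq_col M)).
by move=> /rowV0Pn[u /sub_kermxP uM u0]; exists u.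
Qed.

(** Freeness and spanning are taken modulo null functions, detected by [dot], to match the almost
    everywhere equalities of [has_dim]. *)
Definition is_basis n (P : V -> Prop) (e : 'I_n -> V) := [/\ forall i, P (e i),
  forall u : 'rV_n, dot mu (\sum_i u 0 i *: e i) (\sum_i u 0 i *: e i) = 0 -> u = 0 &
  forall g, P g -> exists u : 'rV_n,
    dot mu (g - \sum_i u 0 i *: e i) (g - \sum_i u 0 i *: e i) = 0].

(** The n+1 coordinate rows have length n, so some nonzero combination of them vanishes. The same
    combination of the functions is only null, whence the conclusion in terms of [dot]. *)
Lemma basis_dependent n (P : V -> Prop) (e : 'I_n -> V) (w : 'I_n.+1 -> V) :
  is_basis P e -> (forall j, P (w j)) ->
  exists2 y : 'rV_n.+1, y != 0 & forall g, dot mu (\sum_j y 0 j *: w j) g = 0.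
Proof.
move=> [_ _ span] Pw; have [c wc] := choice (fun j => span _ (Pw j)).
have [y y0 yc] := left_kernel_neq0 (\matrix_j c j) (ltnSn n).
exists y => // g.
have wE j : dot mu (w j) g = \sum_i c j 0 i * dot mu (e i) g.
  have := dot_eq0 g (wc j); rewrite dotC dotBl dot_suml => /eqP.
  by rewrite subr_eq0 => /eqP ->; apply: eq_bigr => i _; rewrite dotZl.
rewrite dot_suml; under eq_bigr do rewrite dotZl wE mulr_sumr.
rewrite exchange_big big1//= => i _.
have /matrixP/(_ 0 i) := yc; rewrite !mxE => yci.
transitivity ((\sum_j y 0 j * c j 0 i) * dot mu (e i) g).
  by rewrite mulr_suml; apply: eq_bigr => j _; rewrite mulrA.
rewrite [X in X * _](_ : _ = 0) ?mul0r// -[RHS]yci.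
by apply: eq_bigr => j _; rewrite mxE.
Qed.

(** Without projections: after k < n vectors, the coefficients of the next one solve k orthogonality
    equations in n unknowns. A non-null [g] orthogonal to all n vectors would give n+1 pairwise
    orthogonal non-null vectors, against [basis_dependent]. *)
Lemma orthonormal_basis n (P : V -> Prop) (e : 'I_n -> V) : is_basis P e ->
  (forall (u : 'rV_n), P (\sum_i u 0 i *: e i)) -> (forall a g, P g -> P (a *: g)) ->
  exists f : nat -> V, [/\ forall i, (i < n)%N -> P (f i),
    forall i j, (i < n)%N -> (j < n)%N -> dot mu (f i) (f j) = (i == j)%:R &
    forall g, P g -> (forall i, (i < n)%N -> dot mu g (f i) = 0) -> dot mu g g = 0].
Proof.
move=> be Pcomb PZ.
have [f [Pf ortho]] : exists f : nat -> V, (forall i, (i < n)%N -> P (f i)) /\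
    forall i j, (i < n)%N -> (j < n)%N -> dot mu (f i) (f j) = (i == j)%:R.
  have : (n <= n)%N by []; move: {1 3 4 5}n => k.
  elim: k => [_|k IH kn]; first by exists (fun=> 0).
  have [f [Pf ortho]] := IH (ltnW kn).
  have [u u0 uM] := left_kernel_neq0 (\matrix_(i < n, j < k) dot mu (e i) (f j)) kn.
  set v := \sum_i u 0 i *: e i.
  have vf j : (j < k)%N -> dot mu v (f j) = 0.
    move=> jk; have /matrixP/(_ 0 (Ordinal jk)) := uM; rewrite !mxE => uMj.
    by rewrite -[RHS]uMj dot_suml; apply: eq_bigr => i _; rewrite dotZl mxE.
  have v0 : 0 < dot mu v v.
    rewrite lt_neqAle dot_ge0 andbT eq_sym; apply: contra u0 => /eqP v0.
    by case: be => _ free _; rewrite (free u v0).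
  exists (fun i => if (i < k)%N then f i else (norm2 mu v)^-1 *: v); split.
    by move=> i; case: ifPn => ik _; [exact: Pf|exact/PZ/Pcomb].
  have vv : dot mu ((norm2 mu v)^-1 *: v) ((norm2 mu v)^-1 *: v) = 1.
    rewrite dotZl dotZr -sqr_norm2 mulrA -expr2 -exprMn mulVf ?expr1n//.
    by rewrite gt_eqF// sqrtr_gt0.
  move=> i j; rewrite !ltnS => ik jk.
  case: ltnP => ik'; case: ltnP => jk'.
  - exact: ortho.
  - by rewrite dotZr dotC vf// mulr0; case: eqP => // ij; lia.
  - by rewrite dotZl vf// mulr0; case: eqP => // ij; lia.
  - by rewrite vv; case: eqP => // ij; lia.
exists f; split => // g Pg gf.
pose w (j : 'I_n.+1) := if (j < n)%N then f j else g.
have Pw j : P (w j) by rewrite /w; case: ifP => // /Pf.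
have [y y0 yw] := basis_dependent be Pw.
apply/eqP/negPn/negP => g0; move/eqP: y0; apply; apply/rowP => l; rewrite mxE.
have ww j k : j != k -> dot mu (w j) (w k) = 0.
  rewrite -val_eqE /= => jk; rewrite /w; case: ltnP => jn; case: ltnP => kn.
  - by rewrite ortho// (negbTE jk).
  - by rewrite dotC gf.
  - by rewrite gf.
  - have := ltn_ord j; have := ltn_ord k; lia.
have := yw (w l); rewrite dot_suml (bigD1 l)//= big1 ?addr0; last first.
  by move=> j jl; rewrite dotZl ww// mulr0.
rewrite dotZl => /eqP; rewrite mulf_eq0 => /orP[/eqP//|].
rewrite /w; case: ltnP => ln; last by rewrite (negbTE g0).
by rewrite ortho// eqxx oner_eq0.
Qed.

Variables (K : W) (lam : nat -> R).
Hypothesis K_sym : ktr K = K.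

Definition eigvec (t : R) (g : V) := kapp mu K g = t *: g.

Lemma eigvec_orthogonal s t f g : s != t -> eigvec s f -> eigvec t g -> dot mu f g = 0.
Proof.
move=> st Kf Kg; have := dot_kapp mu K f g; rewrite K_sym Kf Kg dotZl dotZr.
by move/eqP; rewrite -subr_eq0 -mulrBl mulf_eq0 subr_eq0 (negbTE st) => /eqP.
Qed.

(** For each nonzero t, a bijection matches the indices k with lam k = t to an orthonormal basis of
    the eigenspace. Gluing these gives [f], with the zero function where lam k = 0; symmetry makes
    different eigenspaces orthogonal. *)
Lemma exists_orthosys : (forall t : R, t != 0 -> exists n : nat,
    ([set k | lam k = t] #= `I_n)%card /\ exists e : 'I_n -> V, is_basis (eigvec t) e) ->
  exists f : nat -> V, [/\ orthosys mu lam f, forall i, eigvec (lam i) (f i) &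
    forall t g, t != 0 -> eigvec t g -> (forall i, dot mu g (f i) = 0) -> dot mu g g = 0].
Proof.
move=> H.
(* The triple consists of the bijection, the basis and the dimension, with arbitrary values at t =
   0. *)
have /choice[F HF] : forall t : R, exists p : (nat -> nat) * (nat -> V) * nat, t != 0 ->
    [/\ set_bij [set k | lam k = t] `I_p.2 p.1.1,
     forall i, (i < p.2)%N -> eigvec t (p.1.2 i),
     forall i j, (i < p.2)%N -> (j < p.2)%N -> dot mu (p.1.2 i) (p.1.2 j) = (i == j)%:R &
     forall g, eigvec t g -> (forall i, (i < p.2)%N -> dot mu g (p.1.2 i) = 0) -> dot mu g g = 0].
  move=> t; have [->|t0] := eqVneq t 0; first by exists (id, (fun=> 0), 0).
  have [n [/card_set_bijP[phi phi_bij] [e be]]] := H t t0.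
  have [||f [Pf ortho complete]] := orthonormal_basis be.
  - move=> u; rewrite /eigvec kapp_sumr scaler_sumr; apply: eq_bigr => i _.
    by rewrite kappZr; case: be => -> _ _; rewrite !scalerA mulrC.
  - by move=> a g; rewrite /eigvec kappZr => ->; rewrite !scalerA mulrC.
  by exists (phi, f, n).
pose f k := if lam k == 0 then 0 else (F (lam k)).1.2 ((F (lam k)).1.1 k).
have idx k : lam k != 0 -> ((F (lam k)).1.1 k < (F (lam k)).2)%N.
  by move=> /HF[[fun_phi _ _] _ _ _]; exact: fun_phi.
have fK i : eigvec (lam i) (f i).
  rewrite /f; case: eqVneq => [->|i0]; first by rewrite /eigvec kapp0r scaler0.
  by case: (HF _ i0) => _ h _ _; apply: h; exact: idx.
exists f; split => //.
  move=> i j; rewrite {1}/f; case: eqVneq => [_|i0]; first by rewrite dot0l andbF.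
  rewrite andbT; have [lij|lij] := eqVneq (lam i) (lam j); last first.
    have := @eigvec_orthogonal _ _ (f i) (f j) lij (fK i) (fK j).
    rewrite {1}/f (negbTE i0) => ->; case: eqP => // ij.
    by rewrite ij eqxx in lij.
  rewrite /f -lij (negbTE i0); have [[_ inj _] _ ortho _] := HF _ i0.
  rewrite ortho ?idx//; last by have := idx j; rewrite -lij; exact.
  suff -> : ((F (lam i)).1.1 i == (F (lam i)).1.1 j) = (i == j) by [].
  by apply/eqP/eqP => [/inj|->//]; rewrite !inE => -> //; rewrite lij.
move=> t g t0 gK gf; have [[_ _ surj] _ _] := HF _ t0; apply => // i /surj [k /= kt <-].
by have := gf k; rewrite /f kt (negbTE t0).
Qed.

End EigenvectorFamily.

(** * Null functions and almost everywhere equality *)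

Section AlmostEverywhere.
Context d (T : measurableType d) (R : realType).
Variable mu : {finite_measure set T -> \bar R}.

Lemma dot_eq0_ae (g : bfun T R) : dot mu g g = 0 <-> ae_eq mu setT g (cst 0).
Proof.
have mgg : measurable_fun setT (fun x => g x * g x).
  by have [] : bmeas (fun x => g x * g x) by bmeasurable.
have mE : measurable_fun setT (fun x => (g x * g x)%:E) by apply/measurable_EFinP.
have := @ae_eq_integral_abs _ T R mu setT measurableT _ mE.
rewrite (eq_integral (fun x => (g x * g x)%:E)); last first.
  by move=> x _; rewrite abse_EFin ger0_norm// -expr2 sqr_ge0.
rewrite -[X in X = 0%E]fineK; last first.
  by apply: integrable_fin_num => //; apply: bmeas_integrable; bmeasurable.
rewrite -/(dot mu g g) => h; split => [g0|g0].
  have /h : (dot mu g g)%:E = 0%E by rewrite g0.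
  by apply: filterS => x /(_ Logic.I) /= [] /eqP; rewrite mulf_eq0 orbb => /eqP.
by apply: EFin_inj; apply/h; apply: filterS g0 => x /(_ Logic.I) /= ->; rewrite mul0r.
Qed.

Lemma ae_Rintegral (f g : T -> R) : measurable_fun setT f -> measurable_fun setT g ->
  ae_eq mu setT f g -> \int[mu]_x f x = \int[mu]_x g x.
Proof.
move=> mf mg fg; congr fine; apply: ae_eq_integral => //.
- exact/measurable_EFinP.
- exact/measurable_EFinP.
- by apply: filterS fg => x /[apply] ->.
Qed.

End AlmostEverywhere.

(** * Lebesgue measure on a symmetric interval *)

Section LebesgueInterval.
Variable R : realType.
Local Notation leb_R := (@lebesgue_measure R).

(** The same set function as [leb], under a name to which finiteness can be attached. *)
Definition lebm (a : R) : set (measurableTypeR R) -> \bar R :=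
  mrestr leb_R (measurable_itv `]- a, a[).

HB.instance Definition _ (a : R) := Measure.on (lebm a).

Let lebm_fin (a : R) : fin_num_fun (lebm a).
Proof.
apply: lty_fin_num_fun => /=; rewrite /lebm /mrestr setTI.
by rewrite lebesgue_measure_itv/=; case: ifP => _; rewrite ?ltry.
Qed.

HB.instance Definition _ (a : R) := @Measure_isFinite.Build _ _ _ (lebm a) (@lebm_fin a).

Lemma lebm_setT (a : R) : 0 <= a -> fine (lebm a setT) = a *+ 2.
Proof.
move=> a0; rewrite /lebm /mrestr setTI lebesgue_measure_itv/= lte_fin.
case: ltP => h /=; first by rewrite opprK mulr2n.
have -> : a = 0 by lra.
by rewrite mul0rn.
Qed.

Lemma ae_lebm (a : R) (P : R -> Prop) : (forall x, x \in `]- a, a[ -> P x) ->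
  {ae lebm a, forall x, P x}.
Proof.
move=> aP; exists (~` `]- a, a[ : set (measurableTypeR R)); split.
- by apply: measurableC; exact: (measurable_itv `]- a, a[).
- by rewrite /lebm/= /mrestr setICl measure0.
- by move=> x /= nP; apply: contra_not nP => /aP.
Qed.

Lemma Rintegral_lebm (a : R) (g : measurableTypeR R -> R) : measurable_fun setT g ->
  \int[leb_R]_(y in `]- a, a[) g y = \int[lebm a]_y g y.
Proof.
move=> mg; congr fine.
have mE : measurable_fun setT (EFin \o g) by exact/measurable_EFinP.
rewrite (eq_measure_integral (lebm a)); last first.
  by move=> A mA AD; rewrite -[in LHS](setIidl AD).
rewrite integral_mkcond; apply: ae_eq_integral => //.
  by apply/measurable_restrict => //; rewrite ?setIT; exact: measurable_funTS.
by apply: ae_lebm => x xa _; rewrite patchE mem_setE xa.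
Qed.

Lemma negligible_set1_lebm (a : R) (x : R) : {ae lebm a, forall y, y != x}.
Proof.
exists [set x]; split.
- exact: measurable_set1.
- rewrite /lebm/= /mrestr; apply/eqP; rewrite eq_le measure_ge0 andbT.
  rewrite -(@lebesgue_measure_set1 R x); apply: le_measure; rewrite ?inE.
  + by apply: measurableI; [exact: measurable_set1|exact: measurable_itv].
  + exact: measurable_set1.
  + by move=> y [].
- by move=> y /= /negP; rewrite negbK => /eqP.
Qed.

(** On a finite measure L^2 is contained in L^1, so a kernel bounded by M sends f to a function
    bounded by M times the integral of |f|. *)
Lemma bounded_kernel_integral (a : R) (K : bfun (measurableTypeR R * measurableTypeR R)%type R)
  (f : measurableTypeR R -> R) : L2 a f ->
  exists h : bfun (measurableTypeR R) R, forall x, h x = \int[lebm a]_y (K (x, y) * f y).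
Proof.
rewrite /L2 /= => f2.
have f1 : f \in Lfun (lebm a) 1.
  by apply: Lfun_subset12 f2; exact: (fin_num_measure (lebm a) setT measurableT).
have fi : (lebm a).-integrable setT (EFin \o f) by exact/Lfun1_integrable.
have /integrableP[mf _] := fi.
have {}mf : measurable_fun setT f by exact/measurable_EFinP.
have [M M0 KM] := bmeas_bound (bfunP K).
have mKf x : measurable_fun setT (fun y => K (x, y) * f y).
  apply: measurable_funM => //.
  by have [] : bmeas (fun y => K (x, y)) by bmeasurable.
have Kfi x : (lebm a).-integrable setT (EFin \o (fun y => K (x, y) * f y)).
  apply: (le_integrable _ _ _ (integrableZl _ M fi)) => //; first exact/measurable_EFinP.
  by move=> y _ /=; rewrite lee_fin !normrM ler_wpM2r// (le_trans (KM _))// ler_norm.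
have bh : bmeas (fun x => \int[lebm a]_y (K (x, y) * f y)).
  split.
    apply: (@measurable_Rintegral_param _ _ _ _ _ _ (fun p => K p * f p.2)).
    apply: measurable_funM; first exact: (bfunP K).1.
    by apply: (measurableT_comp mf); exact: measurable_snd.
  exists (M * \int[lebm a]_y `|f y|) => x.
  apply: le_trans (le_normr_Rintegral _ _) _ => //.
  have fai : (lebm a).-integrable setT (EFin \o (fun y => `|f y|)).
    exact: integrable_abse fi.
  rewrite -RintegralZl//.
  apply: le_Rintegral => //; first exact: (integrable_abse (Kfi x)).
    exact: (integrableZl _ M fai).
  by move=> y _; rewrite normrM ler_wpM2r.
by exists (bf bh).
Qed.

End LebesgueInterval.

(** * From L^2 eigenspaces to bounded eigenvectors *)

Section EigenvaluesOnInterval.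
Variable R : realType.
Local Notation leb_R := (@lebesgue_measure R).
Local Notation V := (bfun (measurableTypeR R) R).
Local Notation W := (bfun (measurableTypeR R * measurableTypeR R)%type R).
Variable a : R.

Lemma bfun_L2 (g : V) : L2 a g.
Proof.
rewrite /L2 /=; rewrite inE/=; apply/andP; split; rewrite inE//=.
  exact: (bfunP g).1.
rewrite /finite_norm unlock poweR_lty//.
under eq_integral => x _/= do rewrite (_ : _ `^ 2 = `|g x| ^+ 2)%R ?powR_mulrn//.
apply/integrable_lty => //; apply: (@bmeas_integrable _ _ _ (lebm a)).
rewrite (_ : (fun x => _) = fun x => g x * g x); first by bmeasurable.
by apply/funext => x; rewrite real_normK ?num_real// expr2.
Qed.

Lemma L2_measurable (f : measurableTypeR R -> R) : L2 a f -> measurable_fun setT f.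
Proof. by rewrite /L2 /= inE => /andP[/[!inE]/=]. Qed.

Variables (k : R -> R -> R) (K : W).
Hypothesis kK : forall p, K p = k p.1 p.2.

Lemma intopE f x : L2 a f -> intop a k f x = \int[lebm a]_y (K (x, y) * f y).
Proof.
move=> /L2_measurable mf; rewrite /intop -Rintegral_lebm.
  by apply: eq_Rintegral => y _; rewrite kK.
apply: measurable_funM => //.
by have [] : bmeas (fun y => K (x, y)) by bmeasurable.
Qed.

Lemma intop_bfun (g : V) x : intop a k g x = kapp (lebm a) K g x.
Proof. by rewrite intopE//; exact: bfun_L2. Qed.

(** The representative h = t^-1 K f agrees with f almost everywhere, so K h = K f at every point;
    the eigenvalue equation for h thus holds everywhere, as [eigvec] demands. *)
Lemma eigenspace_bfun t f : t != 0 -> Defs.eigenspace a (intop a k) t f ->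
  exists h : V, eigvec (lebm a) K t h /\ ae_eq (leb a) setT f h.
Proof.
move=> t0 [f2 Tf]; have [h0 h0E] := bounded_kernel_integral K f2.
have fh : ae_eq (leb a) setT f (t^-1 *: h0 : V).
  apply: filterS Tf => x /(_ Logic.I) Tfx _.
  by rewrite bfunZE h0E -intopE// Tfx mulKf.
exists (t^-1 *: h0); split => //; rewrite /eigvec scalerA mulfV// scale1r.
apply: bfun_ext => x; rewrite kappE h0E; apply: ae_Rintegral.
- by have [] : bmeas (fun y => K (x, y) * (t^-1 *: h0 : V) y) by bmeasurable.
- apply: measurable_funM; last exact: L2_measurable.
  by have [] : bmeas (fun y => K (x, y)) by bmeasurable.
- by apply: filterS fh => y /(_ Logic.I) -> _.
Qed.

(** Each basis vector is replaced by its bounded representative; uniqueness of the coordinates of 0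
    then gives freeness, and their existence gives spanning. *)
Lemma eigenspace_basis t n : t != 0 ->
  has_dim a (Defs.eigenspace a (intop a k) t) n ->
  exists e : 'I_n -> V, is_basis (lebm a) (eigvec (lebm a) K t) e.
Proof.
move=> t0 [e [eV e_uniq]].
have [h hP] := choice (fun i => eigenspace_bfun t0 (eV i)).
have ae_sum (u : 'rV[R]_n) : ae_eq (leb a) setT (fun x => \sum_(i < n) u 0%R i * e i x)
    (\sum_i u 0 i *: h i : V).
  have : {ae leb a, forall x, forall i, e i x = h i x}.
    apply: filter_forall => i; case: (hP i) => _.
    by apply: filterS => x; exact.
  apply: filterS => x eh _; rewrite bfun_sumE; apply: eq_bigr => i _.
  by rewrite bfunZE eh.
exists h; split => [i|u u0|g Kg]; first by case: (hP i).
- have ae0 (w : 'rV[R]_n) : dot (lebm a) (\sum_i w 0 i *: h i) (\sum_i w 0 i *: h i) = 0 ->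
      ae_eq (leb a) setT (cst 0 : measurableTypeR R -> R) (fun x => \sum_(i < n) w 0%R i * e i x).
    move=> /dot_eq0_ae w0; apply: filterS2 w0 (ae_sum w) => x /(_ Logic.I) wx /(_ Logic.I) wx' _.
    by rewrite wx' wx.
  have [|w [_ w_uniq]] := e_uniq (cst 0).
    split; first exact: (bfun_L2 0).
    apply: aeW => x _; rewrite mulr0 (intop_bfun 0).
    by rewrite kapp0r.
  rewrite -(w_uniq u (ae0 u u0)); apply: w_uniq; apply: ae0.
  by rewrite big1 ?dot0l// => i _; rewrite mxE scale0r.
have [|u [gu _]] := e_uniq g.
  split; first exact: bfun_L2.
  by apply: aeW => x _; rewrite intop_bfun Kg.
exists u; apply/dot_eq0_ae; apply: filterS2 gu (ae_sum u) => x /(_ Logic.I) gx /(_ Logic.I) ux _.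
by rewrite bfunDE bfunNE -ux gx subrr.
Qed.

Lemma interval_orthosys lam : ktr K = K -> decreasing_eigenvalues a (intop a k) lam ->
  exists f : nat -> V, [/\ orthosys (lebm a) lam f,
    forall i, eigvec (lebm a) K (lam i) (f i) &
    forall t g, t != 0 -> eigvec (lebm a) K t g ->
      (forall i, dot (lebm a) g (f i) = 0) -> dot (lebm a) g g = 0].
Proof.
move=> K_sym [_ _ H]; apply: exists_orthosys => // t t0.
have [n [cardn dimn]] := H t t0; exists n; split => //.
exact: eigenspace_basis.
Qed.

End EigenvaluesOnInterval.

(** * Transport along a map that rescales the measure *)

Section ImageMeasure.
Context d1 d2 (S : measurableType d1) (T : measurableType d2) (R : realType).
Variables (mu : {finite_measure set S -> \bar R}) (nu : {finite_measure set T -> \bar R}).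
Variables (phi : S -> T) (r : R).
Hypothesis mphi : measurable_fun setT phi.
Hypothesis r_ge0 : 0 <= r.
Hypothesis nuE : forall A, measurable A -> nu A = (r%:E * mu (phi @^-1` A))%E.

Lemma Rintegral_image (g : T -> R) : bmeas g ->
  \int[nu]_y g y = r * \int[mu]_x g (phi x).
Proof.
move=> bg; have bgphi : bmeas (g \o phi) by exact: bmeas_comp.
have mg : measurable_fun setT (EFin \o g) by apply/measurable_EFinP; exact: bg.1.
have mgphi : measurable_fun setT ((EFin \o g) \o phi) by exact: measurableT_comp.
have ge0E (h : T -> \bar R) : measurable_fun setT h -> (forall y, 0 <= h y)%E ->
    (\int[nu]_y h y = r%:E * \int[mu]_x h (phi x))%E.
  move=> mh h0; have := ge0_integral_mscale mu measurableT (NngNum r_ge0)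
    (measurableT_comp mh mphi) (fun x _ => h0 (phi x)).
  move=> /= <-; have := @ge0_integral_pushforward _ _ _ _ _ phi mphi
    (mscale (NngNum r_ge0) mu) setT h measurableT mh (fun y _ => h0 y).
  rewrite preimage_setT => <-; apply: eq_measure_integral => A mA _.
  exact: nuE.
rewrite /Rintegral integralE.
rewrite (ge0E _ (measurable_funepos mg)); last by move=> y; exact: funepos_ge0.
rewrite (ge0E _ (measurable_funeneg mg)); last by move=> y; exact: funeneg_ge0.
rewrite [in RHS]integralE -[r in RHS]/(fine r%:E) -fineM//; last first.
  by rewrite -integralE; apply: integrable_fin_num => //; exact: (bmeas_integrable mu bgphi).
have [fp fn] : (\int[mu]_x (EFin \o g)^\+ (phi x))%E \is a fin_num /\
    (\int[mu]_x (EFin \o g)^\- (phi x))%E \is a fin_num.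
  have ig := bmeas_integrable mu bgphi; split; apply: integrable_fin_num => //.
    by have := integrable_funepos measurableT ig; rewrite (funepos_comp (EFin \o g) phi).
  by have := integrable_funeneg measurableT ig; rewrite (funeneg_comp (EFin \o g) phi).
congr fine; rewrite (funepos_comp (EFin \o g) phi) (funeneg_comp (EFin \o g) phi).
by rewrite [RHS]muleBr// fin_num_adde_defl// fin_numN.
Qed.

Lemma pullb_subproof (g : bfun T R) : bmeas (fun x => Num.sqrt r * g (phi x)).
Proof. by bmeasurable. Qed.

(** The factor [Num.sqrt r] makes the pullback preserve [dot]. *)
Definition pullb (g : bfun T R) : bfun S R := bf (pullb_subproof g).

Lemma pullk_subproof (K : bfun (T * T)%type R) :
  bmeas (fun p : S * S => r * K (phi p.1, phi p.2)).
Proof.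
apply: bmeasM; first exact: bmeas_cst.
by apply: bmeas_bfun; apply: measurable_fun_pair; apply: (measurableT_comp mphi).
Qed.

(** The factor [r] supplies one square root for each variable, so tensors pull back to tensors and
    the coefficients [lam] of an expansion are kept. *)
Definition pullk (K : bfun (T * T)%type R) : bfun (S * S)%type R := bf (pullk_subproof K).

Lemma dot_pullb f g : dot mu (pullb f) (pullb g) = dot nu f g.
Proof.
rewrite [RHS]Rintegral_image; last by bmeasurable.
rewrite -bmeas_RintegralZ; last first.
  by apply: bmeasM; apply: bmeas_bfun.
apply: eq_Rintegral => x _ /=.
by rewrite mulrACA -expr2 sqr_sqrtr.
Qed.

Lemma dot_pullk K L : dot (sqmeas mu) (pullk K) (pullk L) = dot (sqmeas nu) K L.
Proof.
rewrite !dot2E Rintegral_image; last by bmeasurable.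
rewrite -bmeas_RintegralZ; last first.
  apply: (bmeas_comp (f := fun x => \int[nu]_y (K (x, y) * L (x, y))) mphi).
  by bmeasurable.
apply: eq_Rintegral => x _; rewrite Rintegral_image; last by bmeasurable.
rewrite mulrA -bmeas_RintegralZ; last first.
  apply: (bmeas_comp (f := fun y => K (phi x, y) * L (phi x, y)) mphi).
  by bmeasurable.
by apply: eq_Rintegral => y _ /=; rewrite mulrACA.
Qed.

Lemma pullk_kres K lam f m :
  pullk (kres K lam f m) = kres (pullk K) lam (pullb \o f) m.
Proof.
apply: bfun_ext => p; rewrite /kres !(bfunDE, bfunNE, bfun_sumE) /=.
rewrite mulrDr mulrN bfun_sumE mulr_sumr; congr (_ - _); apply: eq_bigr => i _.
transitivity (lam i * (pullb (f i) p.1 * pullb (f i) p.2)); last by [].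
rewrite [in LHS]bfunZE /= -[X in X * _](sqr_sqrtr r_ge0); ring.
Qed.

Lemma orthosys_pullb lam f : orthosys nu lam f -> orthosys mu lam (pullb \o f).
Proof. by move=> ortho i j; rewrite dot_pullb. Qed.

Lemma norm2_pullk_kres K lam f m :
  norm2 (sqmeas mu) (kres (pullk K) lam (pullb \o f) m) =
  norm2 (sqmeas nu) (kres K lam f m).
Proof. by rewrite -pullk_kres /norm2 dot_pullk. Qed.

End ImageMeasure.

(** * Dilation from (-1, 1) to (-W, W) *)

Section Dilation.
Variable R : realType.
Local Notation leb_R := (@lebesgue_measure R).

Definition dilation (W : R) : measurableTypeR R -> measurableTypeR R := fun t => W * t.

Lemma measurable_dilation W : measurable_fun setT (dilation W).
Proof. by apply: measurable_funM => //; exact: measurable_cst. Qed.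

(** Both sides are measures in A that agree on half-open intervals, which determine Lebesgue
    measure. *)
Lemma lebesgue_dilation (W : R) (A : set (measurableTypeR R)) : 0 < W -> measurable A ->
  leb_R A = (W%:E * leb_R (dilation W @^-1` A))%E.
Proof.
move=> W0; have mphi := measurable_dilation W.
unshelve epose (nu := pushforward leb_R (dilation W) : {measure set (measurableTypeR R) -> \bar R}).
  exact: mphi.
pose nu2 : {measure set (measurableTypeR R) -> \bar R} := mscale (NngNum (ltW W0)) nu.
apply: (lebesgue_measure_unique (mu := nu2)) => _ [[x y] _ <-] /=.
rewrite /mscale /= /pushforward.
have -> : dilation W @^-1` `]x, y] = `](x / W), (y / W)]%classic.
  by apply/seteqP; split => t; rewrite /dilation /= !in_itv/= ltr_pdivrMr// ler_pdivlMr// mulrC.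
rewrite !lebesgue_measure_itv/= !lte_fin ltr_pM2r ?invr_gt0//.
case: ifP => _; last by rewrite mule0.
by rewrite -!EFinD -EFinM mulrBr; congr (_%:E); field; rewrite gt_eqF.
Qed.

Lemma lebm_dilation (W : R) (A : set (measurableTypeR R)) : 0 < W -> measurable A ->
  lebm W A = (W%:E * lebm 1 (dilation W @^-1` A))%E.
Proof.
move=> W0 mA; rewrite /lebm /= /mrestr (lebesgue_dilation W0); last first.
  by apply: measurableI => //; exact: measurable_itv.
congr (_ * leb_R _)%E; rewrite preimage_setI; congr (_ `&` _).
apply/seteqP; split => t; rewrite /dilation /= !in_itv/= => /andP[t1 t2];
  apply/andP; split; nra.
Qed.

End Dilation.

(** * Elementary inequalities for the sine *)

Section SineEstimates.
Variable R : realType.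
Implicit Types x v w : R.

Lemma nondecreasing_of_derive (f df : R -> R) (a b : R) :
  (forall x, a <= x <= b -> is_derive x 1 f (df x)) ->
  (forall x, a <= x <= b -> 0 <= df x) ->
  a <= b -> f a <= f b.
Proof.
move=> fdf df0 ab; rewrite -subr_ge0.
have [||c /[!in_itv]/= cab ->] := @MVT_segment R f df a b ab.
- move=> x; rewrite in_itv/= => /andP[ax xb]; apply: fdf.
  by rewrite !ltW.
- apply: derivable_within_continuous => x; rewrite in_itv/= => xab.
  by have [] := fdf x xab.
- by rewrite mulr_ge0 ?subr_ge0// df0.
Qed.

Lemma sin_le_id x : 0 <= x -> sin x <= x.
Proof.
move=> x0; rewrite -subr_ge0.
have := @nondecreasing_of_derive (fun y => y - sin y) (fun y => 1 - cos y) 0 x.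
by rewrite sin0 subrr; apply.
Qed.

(** Integrating sin y <= y gives cos y >= 1 - y^2/2; integrating once more gives the claim. *)
Lemma sin_ge_cubic x : 0 <= x -> x - x ^+ 3 / 6 <= sin x.
Proof.
have cos_ge (y : R) : 0 <= y -> 0 <= cos y - 1 + y ^+ 2 / 2.
  move=> y0.
  have := @nondecreasing_of_derive (fun y => cos y - 1 + y ^+ 2 / 2) (fun y => y - sin y) 0 y.
  rewrite cos0 subrr expr0n /= mul0r addr0; apply => //.
    move=> z _; apply: is_derive_eq.
    by rewrite /GRing.scale /=; field.
  by move=> z /andP[z0 _]; rewrite subr_ge0 sin_le_id.
move=> x0; rewrite -subr_ge0.
have := @nondecreasing_of_derive (fun y => sin y - (y - y ^+ 3 / 6)) (fun y => cos y - 1 + y ^+ 2 / 2) 0 x.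
rewrite sin0 expr0n /= mul0r subr0 subrr; apply => //.
  move=> z _; apply: is_derive_eq.
  by rewrite /GRing.scale /=; field.
by move=> z /andP[z0 _]; exact: cos_ge.
Qed.

Lemma normr_sin_le x : `|sin x| <= `|x|.
Proof.
wlog x0 : x / 0 <= x.
  move=> H; have [/H//|x0] := leP 0 x.
  by rewrite -normrN -(normrN x) -sinN H// oppr_ge0 ltW.
(* Up to 1 the cubic bound makes the sine nonnegative; beyond 1 the bound |sin| <= 1 suffices. *)
rewrite (ger0_norm x0); have [x1|x1] := leP x 1.
  rewrite ger0_norm ?sin_le_id//; apply: le_trans (sin_ge_cubic x0).
  have : x ^+ 3 <= x by rewrite -[leRHS]mulr1 exprS ler_wpM2l// exprn_ile1.
  lra.
apply: le_trans (ltW x1); rewrite ler_norml sin_geN1 sin_le1//.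
Qed.

(** The derivative of sin y / y is -(sin y - y cos y) / y^2, and sin y - y cos y vanishes at 0 and
    has derivative y sin y >= 0 on [0, pi]. *)
Lemma sin_div_nincr v w : 0 < v -> v <= w -> w <= pi -> sin w / w <= sin v / v.
Proof.
move=> v0 vw wpi.
have k_ge0 (y : R) : 0 <= y -> y <= pi -> 0 <= sin y - y * cos y.
  move=> y0 ypi.
  have := @nondecreasing_of_derive (fun y => sin y - y * cos y) (fun y => y * sin y) 0 y.
  rewrite sin0 mul0r subrr; apply => //.
    move=> z _; apply: is_derive_eq.
    by rewrite /GRing.scale /=; ring.
  move=> z /andP[z0 zy]; rewrite mulr_ge0// sin_ge0_pi// z0/=.
  exact: le_trans ypi.
rewrite -lerN2.
apply: (@nondecreasing_of_derive (fun y => - (sin y / y)) (fun y => (sin y - y * cos y) / y ^+ 2)) => //.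
  move=> y /andP[vy yw]; have y0 : y != 0 by rewrite gt_eqF// (lt_le_trans v0).
  have dV : is_derive y 1 (fun z : R => z^-1) (- y ^- 2).
    by have := @is_deriveV R id y 1 1 y0 (is_derive_id y 1); rewrite /GRing.scale /= mulr1.
  apply: is_derive_eq.
  by rewrite /GRing.scale /=; field.
move=> y /andP[vy yw]; rewrite divr_ge0 ?sqr_ge0// k_ge0//.
  by rewrite ltW// (lt_le_trans v0).
exact: le_trans yw wpi.
Qed.

(** For v > 0 the difference is (v - sin v) / (v sin v), at most v^2 / (6 sin v) by the cubic bound,
    and v / sin v does not decrease up to w. Negative v follow by oddness. *)
Lemma inv_sin_gap v w : v != 0 -> `|v| <= w -> w < pi ->
  `|(sin v)^-1 - v^-1| <= w ^+ 2 / (6 * sin w).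
Proof.
wlog v0 : v / 0 < v.
  move=> H vn0; have [v0|v0|v0] := ltgtP 0 v; last by rewrite -v0 eqxx in vn0.
    exact: H.
  have -> : (sin v)^-1 - v^-1 = - ((sin (- v))^-1 - (- v)^-1).
    by rewrite sinN !invrN; ring.
  by move=> vw wpi; rewrite normrN H ?oppr_eq0 ?oppr_gt0 ?normrN.
move=> _; rewrite (gtr0_norm v0) => vw wpi.
have sv : 0 < sin v by rewrite sin_gt0_pi// v0 (le_lt_trans vw).
have w0 : 0 < w by exact: lt_le_trans vw.
have sw : 0 < sin w by rewrite sin_gt0_pi// w0.
rewrite ger0_norm; last first.
  by rewrite subr_ge0 lef_pV2 ?posrE// sin_le_id// ltW.
have svw := sin_div_nincr v0 vw (ltW wpi).
have cub := sin_ge_cubic (ltW v0).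
have -> : (sin v)^-1 - v^-1 = (v - sin v) / (v * sin v).
  by field; rewrite !gt_eqF.
apply: (@le_trans _ _ (v ^+ 2 / (6 * sin v))).
  rewrite ler_pdivrMr ?mulr_gt0// (_ : v ^+ 2 / (6 * sin v) * (v * sin v) = v ^+ 3 / 6); last by field; rewrite gt_eqF.
  lra.
rewrite ler_pdivrMr ?mulr_gt0// mulrAC ler_pdivlMr ?mulr_gt0//.
have h : sin w * v <= sin v * w.
  by move: svw; rewrite ler_pdivrMr// mulrAC ler_pdivlMr.
have : v * (sin w * v) <= w * (sin v * w).
  apply: ler_pM => //; [exact: ltW|by rewrite mulr_ge0// ltW].
rewrite !expr2; lra.
Qed.

End SineEstimates.

(** * The Dirichlet and sinc kernels: boundedness, finite rank and distance *)

Section ConvolutionKernels.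
Variable R : realType.
Local Notation U := (measurableTypeR R).
Local Notation V := (bfun U R).
Local Notation W2 := (bfun (U * U)%type R).

(* 1/x = x (x^2)^(-1), where the last power is [powR]; at 0 both sides are 0. *)
Lemma measurable_inv : measurable_fun setT (fun x : U => x^-1 : U).
Proof.
have -> : (fun x : U => x^-1 : U) = fun x : U => (x * (x ^+ 2) `^ (-1))%R.
  apply/funext => x; rewrite powR_inv1 ?sqr_ge0//.
  have [->|x0] := eqVneq (x : R) 0; first by rewrite mul0r invr0.
  by field.
apply: measurable_funM => //.
by apply: (measurableT_comp (measurable_powR _)); exact: measurable_funX.
Qed.

Lemma measurable_sin : measurable_fun setT (fun x : U => sin x : U).
Proof. by apply: continuous_measurable_fun; exact: continuous_sin. Qed.

Lemma measurable_cos : measurable_fun setT (fun x : U => cos x : U).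
Proof. by apply: continuous_measurable_fun; exact: continuous_cos. Qed.

Lemma measurable_mull (a : R) : measurable_fun setT (fun x : U => a * x : U).
Proof. by apply: measurable_funM => //; exact: measurable_cst. Qed.

Lemma bmeas_convolution (phi : U -> R) :
  bmeas phi -> bmeas (fun p : U * U => phi (p.1 - p.2)).
Proof.
apply: (bmeas_comp (u := fun p : U * U => (p.1 - p.2 : U))).
by apply: measurable_funB; [exact: measurable_fst|exact: measurable_snd].
Qed.

(** Induction by the addition formula; this bounds the Dirichlet kernel by N. *)
Lemma normr_sin_muln n (t : R) : `|sin (n%:R * t)| <= n%:R * `|sin t|.
Proof.
elim: n => [|n IH]; first by rewrite !mul0r sin0 normr0.
rewrite -natr1 mulrDl mul1r sinD (le_trans (ler_normD _ _))// mulrDl mul1r lerD//.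
  rewrite normrM (le_trans _ IH)// ler_piMr// ler_norml.
  by rewrite cos_geN1 cos_le1.
by rewrite normrM mulrC ler_piMr// ler_norml cos_geN1 cos_le1.
Qed.

Lemma bmeas_dirichlet N :
  bmeas (fun u : U => sin (N%:R * pi * u) / sin (pi * u)).
Proof.
split; last first.
  exists N%:R => u; rewrite normrM normfV -mulrA.
  have [->|s0] := eqVneq (sin (pi * u)) 0; first by rewrite normr0 invr0 mulr0.
  by rewrite ler_pdivrMr ?normr_gt0// normr_sin_muln.
apply: measurable_funM.
  by apply: (measurableT_comp measurable_sin); exact: measurable_mull.
apply: (measurableT_comp measurable_inv); apply: (measurableT_comp measurable_sin).
exact: measurable_mull.
Qed.

Lemma bmeas_sinc (c : R) : bmeas (fun u : U => sin (c * u) / (pi * u)).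
Proof.
split; last first.
  exists (`|c| / pi) => u; rewrite normrM normfV normrM (gtr0_norm (pi_gt0 R)).
  have [->|u0] := eqVneq (u : R) 0.
    by rewrite normr0 !mulr0 invr0 mulr0 divr_ge0// pi_ge0.
  rewrite invfM mulrCA mulrC ler_wpM2r ?invr_ge0 ?pi_ge0//.
  by rewrite ler_pdivrMr ?normr_gt0// -normrM normr_sin_le.
apply: measurable_funM.
  by apply: (measurableT_comp measurable_sin); exact: measurable_mull.
by apply: (measurableT_comp measurable_inv); exact: measurable_mull.
Qed.

Definition dirichletk N : W2 := bf (bmeas_convolution (bmeas_dirichlet N)).

Definition sinck (c : R) : W2 := bf (bmeas_convolution (bmeas_sinc c)).

Lemma ktr_dirichletk N : ktr (dirichletk N) = dirichletk N.
Proof.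
apply: bfun_ext => -[x y] /=; rewrite -(opprB x y) !mulrN !sinN invrN.
by rewrite mulrNN.
Qed.

Lemma ktr_sinck c : ktr (sinck c) = sinck c.
Proof.
apply: bfun_ext => -[x y] /=; rewrite -(opprB x y) !mulrN !sinN invrN.
by rewrite mulrNN.
Qed.

(** Telescoping: 2 sin t cos((2k + 1 - N) t) = sin((2k + 2 - N) t) - sin((2k - N) t). *)
Lemma dirichlet_sum N (t : R) :
  sin t * \sum_(k < N) cos ((2 * k%:R + 1 - N%:R) * t) = sin (N%:R * t).
Proof.
pose s k : R := sin ((2 * k%:R - N%:R) * t).
have sE k : 2 * (sin t * cos ((2 * k%:R + 1 - N%:R) * t)) = s k.+1 - s k.
  rewrite /s (_ : (2 * k.+1%:R - N%:R) * t = (2 * k%:R + 1 - N%:R) * t + t); last first.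
    by rewrite -natr1; ring.
  rewrite (_ : (2 * k%:R - N%:R) * t = (2 * k%:R + 1 - N%:R) * t - t); last by ring.
  by rewrite sinB sinD; ring.
have tele m : \sum_(k < m) (s k.+1 - s k) = s m - s 0%N.
  elim: m => [|m IH]; first by rewrite big_ord0 subrr.
  by rewrite big_ord_recr /= IH; ring.
have := tele N.
rewrite (eq_bigr (fun k : 'I_N => 2 * (sin t * cos ((2 * k%:R + 1 - N%:R) * t)))).
  2: by move=> k _; rewrite sE.
rewrite -mulr_sumr -mulr_sumr /s mulr0 sub0r mulNr sinN.
rewrite (_ : (2 * N%:R - N%:R) * t = N%:R * t); last by ring.
by lra.
Qed.

Lemma bmeas_cos_lin (b : R) : bmeas (fun x : U => cos (b * x)).
Proof.
split; first by apply: (measurableT_comp measurable_cos); exact: measurable_mull.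
by exists 1 => x; rewrite ler_norml cos_geN1 cos_le1.
Qed.

Lemma bmeas_sin_lin (b : R) : bmeas (fun x : U => sin (b * x)).
Proof.
split; first by apply: (measurableT_comp measurable_sin); exact: measurable_mull.
by exists 1 => x; rewrite ler_norml sin_geN1 sin_le1.
Qed.

(** The cosine of a difference splits into two products, so the N cosines of [dirichlet_sum] give 2N
    tensors. Used with theta = pi, s = 1 for the Dirichlet kernel, and with theta = pi W / p, s = W
    / p to approximate the sinc kernel. *)
Lemma dirichlet_finite_rank N (theta s : R) : exists n (u v : 'I_n -> V), forall x y,
  sin (theta * (x - y)) != 0 ->
  (\sum_(i < n) tens (u i) (v i)) (x, y) =
  s * (sin (N%:R * (theta * (x - y))) / sin (theta * (x - y))).
Proof.
pose b (k : 'I_N) : R := (2 * k%:R + 1 - N%:R) * theta.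
pose w (i : 'I_(N + N)) : V := match fintype.split i with
  | inl k => bf (bmeas_cos_lin (b k)) | inr k => bf (bmeas_sin_lin (b k)) end.
exists (N + N)%N, (fun i => s *: w i), w => x y sin0.
rewrite -dirichlet_sum mulrAC mulfV// mul1r mulr_sumr.
transitivity (\sum_(i < N + N) s * (w i x * w i y)).
  by rewrite bfun_sumE; apply: eq_bigr => i _; rewrite mulrA.
rewrite big_split_ord /= -big_split /=; apply: eq_bigr => k _.
rewrite /w (unsplitK (inl k)) (unsplitK (inr k)) /=.
rewrite (_ : (2 * k%:R + 1 - N%:R) * (theta * (x - y)) = b k * x - b k * y).
  by rewrite cosB; ring.
by rewrite /b; ring.
Qed.

(* The bound is not assumed on the diagonal, where the quotients defining the
   two kernels take the junk value 0. *)
Lemma norm2_le_offdiag (a delta : R) (G : W2) : 0 <= a -> 0 <= delta ->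
  (forall x y, x \in `]- a, a[ -> y \in `]- a, a[ -> x != y -> `|G (x, y)| <= delta) ->
  norm2 (sqmeas (lebm a)) G <= delta * (a *+ 2).
Proof.
move=> a0 d0 Gd; have a20 : 0 <= a *+ 2 by rewrite mulrn_wge0.
have ae_le (f : U -> R) B : bmeas f -> {ae lebm a, forall x, f x <= B} ->
    \int[lebm a]_x f x <= B * (a *+ 2).
  move=> bf fB; have bmin : bmeas (fun x => Num.min (f x) B).
    split; first by apply: measurable_minr; [exact: bf.1|exact: measurable_cst].
    have [M _ fM] := bmeas_bound bf; exists (M + `|B|) => x.
    have := fM x; have := normr_ge0 (f x); have := normr_ge0 B.
    by rewrite /Num.min; case: ifP => _; lra.
  rewrite (@ae_Rintegral _ _ _ (lebm a) f (fun x => Num.min (f x) B)).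
  - apply: (@le_trans _ _ (\int[lebm a]_x (fun=> B) x)).
      apply: bmeas_le_Rintegral => //; first exact: bmeas_cst.
      by move=> x; rewrite ge_min lexx orbT.
    by rewrite Rintegral_cst// lebm_setT.
  - exact: bf.1.
  - exact: bmin.1.
  - by apply: filterS fB => x fx _; rewrite min_l.
rewrite -(ler_pXn2r (n := 2)) ?nnegrE ?norm2_ge0 ?mulr_ge0//.
rewrite sqr_norm2 dot2E.
rewrite (_ : _ ^+ 2 = delta ^+ 2 * (a *+ 2) * (a *+ 2)); last by ring.
apply: (ae_le _ _); first by bmeasurable.
apply: ae_lebm => x xa; apply: (ae_le _ _); first by bmeasurable.
have ya : {ae lebm a, forall y, y \in `]- a, a[} by apply: ae_lebm.
have FF : Filter (almost_everywhere (lebm a)) := ae_filter_ringOfSetsType (lebm a).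
apply: filterS2 ya (negligible_set1_lebm a x) => y ya yx.
rewrite -expr2 -real_normK ?num_real// ler_pXn2r ?nnegrE//.
by apply: Gd => //; rewrite eq_sym.
Qed.

(** W times the bound of [inv_sin_gap] at w = 2 pi W, which dominates |pi W u| for |u| < 2. It is
    half the constant of the theorem; the other factor 2 is the length of (-1, 1). *)
Definition gap (W : R) := W * ((2 * pi * W) ^+ 2 / (6 * sin (2 * pi * W))).

Lemma gap_ge0 (W : R) : 0 < W < 1 / 2 -> 0 <= gap W.
Proof.
move=> /andP[W0 W1]; have pi0 := pi_gt0 R.
rewrite /gap mulr_ge0 ?(ltW W0)// divr_ge0 ?sqr_ge0// mulr_ge0// ltW//.
by rewrite sin_gt0_pi//; apply/andP; split; nra.
Qed.

Lemma sin_neq0 (v : R) : v != 0 -> `|v| < pi -> sin v != 0.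
Proof.
move=> v0 vpi; have : 0 < sin `|v| by rewrite sin_gt0_pi// normr_gt0 v0.
by case: (ger0P v) => _ h; [rewrite gt_eqF|rewrite -oppr_eq0 -sinN gt_eqF].
Qed.

Lemma sinc_dirichlet_gap (W : R) N (u : R) : 0 < W < 1 / 2 -> `|u| < 2 ->
  `|W * (sin (N%:R * (pi * W * u)) / sin (pi * W * u)) -
    sin (pi * N%:R * W * u) / (pi * u)| <= gap W.
Proof.
move=> /[dup] W01 /andP[W0 W1] u2; have pi0 := pi_gt0 R.
have [->|u0] := eqVneq u 0.
  by rewrite !mulr0 sin0 !mul0r mulr0 subrr normr0 gap_ge0.
pose v := pi * W * u.
have v0 : v != 0 by rewrite /v !mulf_neq0// gt_eqF.
have vw : `|v| <= 2 * pi * W.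
  rewrite /v normrM gtr0_norm ?mulr_gt0//.
  by rewrite (_ : 2 * pi * W = pi * W * 2) ?ler_pM2l ?mulr_gt0 ?(ltW u2)//; ring.
have wpi : 2 * pi * W < pi by nra.
have -> : pi * N%:R * W * u = N%:R * v by rewrite /v; ring.
rewrite -/v.
have -> : W * (sin (N%:R * v) / sin v) - sin (N%:R * v) / (pi * u) =
    W * (sin (N%:R * v) * ((sin v)^-1 - v^-1)).
  have -> : (pi * u)^-1 = W * v^-1.
    rewrite /v; move: (@pi R) pi0 => q q0; field; by rewrite u0 !gt_eqF.
  by move: (sin v)^-1 (v^-1) => A B; ring.
rewrite normrM (gtr0_norm W0) /gap ler_wpM2l ?(ltW W0)// normrM.
apply: le_trans (inv_sin_gap v0 vw wpi).
by rewrite ler_piMl// ler_norml sin_geN1 sin_le1.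
Qed.

(** Off the diagonal the kernel is exactly a finite sum of tensors, so the difference has norm 0. *)
Lemma dirichletk_finite_rank (W : R) N eps : 0 < W < 1 / 2 -> 0 < eps ->
  exists n (u v : 'I_n -> V),
    norm2 (sqmeas (lebm W)) (dirichletk N - \sum_(i < n) tens (u i) (v i)) <= eps.
Proof.
move=> /andP[W0 W1] eps0; have pi0 := pi_gt0 R.
have [n [u [v uvE]]] := dirichlet_finite_rank N pi 1.
exists n, u, v; apply: le_trans (ltW eps0).
rewrite -(mul0r (W *+ 2)); apply: norm2_le_offdiag => //; first exact: ltW.
move=> x y xa ya xy.
have [[x1 x2] [y1 y2]] : (- W < x /\ x < W) /\ (- W < y /\ y < W).
  by move: xa ya; rewrite !in_itv => /andP[? ?] /andP[? ?].
rewrite bfunDE bfunNE uvE /=; last first.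
  apply: sin_neq0; first by rewrite mulf_neq0 ?subr_eq0// gt_eqF.
  rewrite normrM gtr0_norm// gtr_pMr// ltr_norml; lra.
by rewrite mul1r mulrA subrr normr0.
Qed.

(** If w = 2 pi W / p <= 1 then sin w >= w / 2, so w^2 / (6 sin w) <= 1 and the gap is at most W /
    p. *)
Lemma gap_small (W eps : R) : 0 < W < 1 / 2 -> 0 < eps ->
  exists2 p, (0 < p)%N & gap (W / p%:R) * 2 <= eps.
Proof.
move=> /andP[W0 W1] eps0; have pi0 := pi_gt0 R.
(* The first summand forces w <= 1, the second 2 W / p <= eps. *)
pose B := 2 * pi * W + 2 * W / eps.
have B0 : 0 <= B by rewrite addr_ge0// ?divr_ge0// ?mulr_ge0// ltW.
have := archi_boundP B0; set p := Num.bound B => Bp.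
have p0 : (0 : R) < p%:R by exact: le_lt_trans Bp.
exists p; first by rewrite -(ltr0n R).
set Wp := W / p%:R; have Wp0 : 0 < Wp by rewrite divr_gt0.
pose w := 2 * pi * Wp.
have w0 : 0 < w by rewrite /w mulr_gt0// mulr_gt0.
have w1 : w <= 1.
  rewrite /w /Wp mulrA ler_pdivrMr// mul1r (le_trans _ (ltW Bp))// lerDl.
  by rewrite divr_ge0// ?mulr_ge0// ltW.
have Wpe : Wp * 2 <= eps.
  rewrite /Wp mulrAC ler_pdivrMr// (mulrC eps) -ler_pdivrMr// (mulrC W 2).
  rewrite (le_trans _ (ltW Bp))//.
  by rewrite lerDr mulr_ge0// ?mulr_ge0// ltW.
have sw : w / 2 <= sin w.
  apply: le_trans (sin_ge_cubic (ltW w0)).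
  have : w ^+ 3 <= w by rewrite -[leRHS]mulr1 exprS ler_wpM2l ?(ltW w0)// exprn_ile1// ltW.
  lra.
have sw0 : 0 < sin w by apply: lt_le_trans sw; rewrite divr_gt0.
apply: le_trans Wpe; rewrite ler_pM2r// /gap -/w ler_piMr ?(ltW Wp0)//.
rewrite ler_pdivrMr ?mulr_gt0// mul1r expr2.
nra.
Qed.

(** The product N W is unchanged when N becomes N p and W becomes W / p. Off the diagonal the same
    sinc kernel is thus within gap (W / p) of a rescaled Dirichlet kernel of finite rank, for every
    p. *)
Lemma sinck_finite_rank (W : R) N eps : 0 < W < 1 / 2 -> 0 < eps ->
  exists n (u v : 'I_n -> V),
    norm2 (sqmeas (lebm 1)) (sinck (pi * N%:R * W) - \sum_(i < n) tens (u i) (v i)) <= eps.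
Proof.
move=> W01 eps0; have pi0 := pi_gt0 R; have /andP[W0 W1] := W01.
have [p p0 gap_p] := gap_small W01 eps0.
have p0R : (0 : R) < p%:R by rewrite ltr0n.
have Wp0 : 0 < W / p%:R by rewrite divr_gt0.
have Wp1 : W / p%:R < 1 / 2.
  rewrite ltr_pdivrMr//; have : (1 : R) <= p%:R by rewrite ler1n.
  nra.
have [n [u [v uvE]]] := dirichlet_finite_rank (N * p) (pi * (W / p%:R)) (W / p%:R).
exists n, u, v; apply: le_trans gap_p.
apply: norm2_le_offdiag => //; first by rewrite gap_ge0// Wp0.
move=> x y xa ya xy.
have [[x1 x2] [y1 y2]] : (- 1 < x /\ x < 1) /\ (- 1 < y /\ y < 1).
  by move: xa ya; rewrite !in_itv => /andP[? ?] /andP[? ?].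
have xy2 : `|x - y| < 2 by rewrite ltr_norml; lra.
rewrite bfunDE bfunNE uvE /=; last first.
  apply: sin_neq0; first by rewrite !mulf_neq0 ?subr_eq0// ?invr_neq0// gt_eqF.
  rewrite normrM gtr0_norm; last exact: mulr_gt0.
  have := normr_ge0 (x - y).
  rewrite -mulrA gtr_pMr//; move: (`|x - y|) (W / p%:R) xy2 Wp0 Wp1 => z q z2 q0 q1 z0; nra.
rewrite distrC; have := @sinc_dirichlet_gap (W / p%:R) (N * p) (x - y).
rewrite Wp0 Wp1 => /(_ isT xy2).
rewrite (_ : pi * (N * p)%:R * (W / p%:R) = pi * N%:R * W)//.
by rewrite natrM; move: (@pi R) => q; field; rewrite gt_eqF.
Qed.

End ConvolutionKernels.

(** * Comparison of the two lists of eigenvalues *)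

Lemma eigenvalue_gap_le (R : realType) (W : R) (N : nat) (lamt lam : nat -> R) n :
  0 < W < 1 / 2 -> decreasing_eigenvalues W (Qtilde W N) lamt ->
  decreasing_eigenvalues 1 (Qsinc (pi * N%:R * W)) lam ->
  \sum_(k < n) (lamt k - lam k) ^+ 2 <= (gap W * 2) ^+ 2.
Proof.
move=> /[dup] W01 /andP[W0 W1] hlamt hlam.
set c := pi * N%:R * W in hlam *.
have [f [f_ortho f_eig f_complete]] :=
  @interval_orthosys R W _ (dirichletk R N) (fun p => erefl) lamt (ktr_dirichletk R N) hlamt.
have [g [g_ortho g_eig g_complete]] :=
  @interval_orthosys R 1 _ (sinck c) (fun p => erefl) lam (ktr_sinck c) hlam.
have [lamt_ni lamt0 _] := hlamt; have [lam_ni lam0 _] := hlam.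
have nuE A := @lebm_dilation R W A W0.
have mphi := @measurable_dilation R W.
have res_f := kres_cvg0 (ktr_dirichletk R N) lamt_ni lamt0 f_ortho f_eig f_complete
  (fun eps => dirichletk_finite_rank N W01).
have res_g := kres_cvg0 (ktr_sinck c) lam_ni lam0 g_ortho g_eig g_complete
  (fun eps => sinck_finite_rank N W01).
(* The Dirichlet side is transported from (-W, W) to (-1, 1), keeping its eigenvalues and the norms
   of its residuals. *)
have f'_ortho := orthosys_pullb mphi (ltW W0) nuE f_ortho.
have resE := @norm2_pullk_kres _ _ _ _ R (lebm 1) (lebm W) (dilation W) W mphi (ltW W0) nuE
  (dirichletk R N) lamt f.
have res_f' : (fun m => norm2 (sqmeas (lebm 1)) (kres (pullk W mphi (dirichletk R N)) lamt
    (pullb W mphi \o f) m)) @ \oo --> 0.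
  have -> := funext resE.
  exact: res_f.
have HW := Hoffman_Wielandt n lamt_ni lamt0 lam_ni lam0 f'_ortho g_ortho res_f' res_g.
apply: (le_trans HW).
have gap2 : 0 <= gap W * 2 by rewrite mulr_ge0// gap_ge0.
rewrite -sqr_norm2 ler_pXn2r ?nnegrE ?norm2_ge0//.
apply: norm2_le_offdiag => //; first exact: gap_ge0.
move=> x y xa ya _.
have [[x1 x2] [y1 y2]] : (- 1 < x /\ x < 1) /\ (- 1 < y /\ y < 1).
  by move: xa ya; rewrite !in_itv => /andP[? ?] /andP[? ?].
have xy2 : `|x - y| < 2 by rewrite ltr_norml; lra.
rewrite bfunDE bfunNE /= /dilation -mulrBr.
by have := sinc_dirichlet_gap N W01 xy2; rewrite !mulrA -!(mulrA _ pi W) -!mulrA.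
Qed.

Theorem proposition1 (R : realType) (W : R) (N : nat) (c : R)
    (lamt lam : nat -> R)
    (hW : 0 < W < 1 / 2)
    (hN : (1 <= N)%N)
    (hc : c = pi * N%:R * W)
    (hlamt : decreasing_eigenvalues W (Qtilde W N) lamt)
    (hlamt0 : forall k : nat, (N <= k)%N -> lamt k = 0)
    (hlam : decreasing_eigenvalues 1 (Qsinc c) lam) :
  ((\sum_(0 <= k <oo) (`|lamt k - lam k| ^+ 2)%:E) `^ (1 / 2)
     <= (W ^+ 3 * (4 * pi ^+ 2 / (3 * sin (2 * pi * W))))%:E)%E.
Proof.
rewrite {}hc in hlam.
have gapE : gap W * 2 = W ^+ 3 * (4 * pi ^+ 2 / (3 * sin (2 * pi * W))).
  have /andP[W0 W1] := hW; have pi0 := pi_gt0 R.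
  have : sin (2 * pi * W) != 0.
    by rewrite gt_eqF// sin_gt0_pi//; apply/andP; split; nra.
  by rewrite /gap; move: (sin _) => s s0; move: (@pi R) => p; field.
(* The bound on the partial sums does not depend on their length, so it passes to the series. *)
have sum_le : (\sum_(0 <= k <oo) (`|lamt k - lam k| ^+ 2)%:E <= ((gap W * 2) ^+ 2)%:E)%E.
  apply: lime_le; first by apply: is_cvg_nneseries => k _ _; rewrite lee_fin sqr_ge0.
  apply: nearW => n; rewrite big_mkord sumEFin lee_fin.
  under eq_bigr do rewrite real_normK ?num_real//.
  exact: eigenvalue_gap_le hlamt hlam.
rewrite -gapE.
have gap0 : 0 <= gap W * 2 by rewrite mulr_ge0// gap_ge0.
apply: (@le_trans _ _ (((gap W * 2) ^+ 2)%:E `^ (1 / 2))%E).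
  apply: gt0_ler_poweR => //; rewrite ?in_itv/= ?leey ?andbT//.
  - by apply: nneseries_ge0 => k _ _; rewrite lee_fin sqr_ge0.
  - by rewrite lee_fin sqr_ge0.
by rewrite poweR_EFin mul1r powR12_sqrt ?sqr_ge0// sqrtr_sqr ger0_norm.
Qed.
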